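(* Let $B=\mathrm{diag}\bigl(\exp(2\pi i\lambda_1),\dots,\exp(2\pi i\lambda_n)\bigr)$ for some $\lambda_1,\dots,\lambda_n\in\mathbb{C}$. Then the corresponding solution $r_B$ of the associative Yang--Baxter equation, constructed in the context, is given by the following formula: $$r_B(v,y)=\sum_{k,l=1}^n\sigma(v-\lambda_{kl},y)\,e_{l,k}\otimes e_{k,l},$$ where $\lambda_{kl}=\lambda_k-\lambda_l$ for all $1\le k,l\le n$ and $\sigma(u,x)$ is the Kronecker function.
   Context: Let $n\ge1$, $\tau\in\mathbb{C}$ with $\mathrm{Im}(\tau)>0$, $\Lambda=\mathbb{Z}+\tau\mathbb{Z}$, and, for $B\in \mathrm{GL}_n(\mathbb{C})$, let $\Sigma_B=\{\lambda-\lambda' : \exp(2\pi i\lambda),\exp(2\pi i\lambda')\text{ are eigenvalues of }B\}+\Lambda\subset\mathbb{C}$. $e_{a,b}$ denotes the elementary $n\times n$ matrix with entry $1$ in position $(a,b)$. With $q=\exp(\pi i\tau)$: $\theta(z)=2q^{1/4}\sum_{m=0}^\infty(-1)^mq^{m(m+1)}\sin((2m+1)\pi z)$ is the first Jacobian theta-function, $\bar\theta(z)=\sum_{m\in\mathbb{Z}}\exp(\pi im^2\tau+2\pi imz)$ is the third Jacobian theta-function, and the Kronecker function is $\sigma(u,x)=\dfrac{\theta'(0)\theta(u+x)}{\theta(u)\theta(x)}$. Construction of $r_B(v,y)$ for $v\in\mathbb{C}\setminus\Sigma_B$ and $y\in\mathbb{C}\setminus\Lambda$. Let $e(z)=-\exp(-2\pi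 i(z+v+\tau))$ and let $\mathrm{Sol}_{B,v,\tau}$ be the complex vector space of holomorphic functions $\Phi:\mathbb{C}\to \mathrm{Mat}_{n\times n}(\mathbb{C})$ with $\Phi(z+1)=\Phi(z)$ and $\Phi(z+\tau)B=e(z)B\Phi(z)$. Let $\mathrm{res}_0(\Phi)=\Phi(0)$, which is an isomorphism $\mathrm{Sol}_{B,v,\tau}\to \mathrm{Mat}_{n\times n}(\mathbb{C})$ since $v\notin\Sigma_B$, and let $\mathrm{ev}_y(\Phi)=\frac{1}{\bar\theta(y+\frac{\tau+1}{2})}\Phi(y)$. Put $\tilde r_B(v,y)=\mathrm{ev}_y\circ \mathrm{res}_0^{-1}$, and let $r_B(v,y)\in \mathrm{Mat}_{n\times n}(\mathbb{C})\otimes \mathrm{Mat}_{n\times n}(\mathbb{C})$ be the tensor corresponding to the linear map $\tilde r_B(v,y)$ under the isomorphism sending $X\otimes Y$ to the linear map $Z\mapsto \mathrm{Tr}(XZ)Y$. The function $r=r_B$ is a solution of the associative Yang--Baxter equation $r^{12}(u,x)\,r^{23}(u+v,y)=r^{13}(u+v,x+y)\,r^{12}(-v,x)+r^{23}(v,y)\,r^{13}(u,x+y)$, where the upper indices indicate the embeddings of $A\otimes A$ into $A\otimes A\otimes A$ for $A=\mathrm{Mat}_{n\times n}(\mathbb{C})$ (for example, $r^{13}$ is obtained by applying $a\otimes b\mapsto a\otimes 1\otimes b$).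
   Formalization: The formula is proved with the right-hand side divided by the derivative of the third theta-function at (τ+1)/2; with res_0(Φ)=Φ(0) the printed formula is off by exactly this factor (e.g. it is purely imaginary, so not 1, for τ=i). *)

(* Defs.v *)
From HB Require Import structures.
From mathcomp Require Import all_boot all_order all_algebra.
From mathcomp Require Import complex mxtens.
From mathcomp Require Import all_classical all_reals all_analysis.

Set Implicit Arguments.
Unset Strict Implicit.
Unset Printing Implicit Defensive.

Import Order.TTheory GRing.Theory Num.Theory.
Import numFieldNormedType.Exports.

Local Open Scope classical_set_scope.
Local Open Scope complex_scope.
Local Open Scope ring_scope.

Definition iC {R : realType} : R[i] := 0 +i* 1.
Definition piC {R : realType} : R[i] := (pi : R)%:C.

Definition expC {R : realType} (z : R[i]) : R[i] :=
  (expR (complex.Re z))%:C * (cos (complex.Im z) +i* sin (complex.Im z)).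

Definition sinC {R : realType} (z : R[i]) : R[i] :=
  (expC (iC * z) - expC (- (iC * z))) / (2 * iC).

Section Theta.
Variables (R : realType) (tau : R[i]).
Local Notation C := (R[i]).

(* [nome_pow s] is q^s for q = exp (pi i tau); for fractional s, this fixes
   the branch, so that q^(1/4) = exp (pi i tau / 4). *)
Definition nome_pow (s : C) : C := expC (s * (piC * iC * tau)).

Definition theta (z : C) : C :=
  2 * nome_pow (4^-1) *
  limn (series (fun m : nat => (-1) ^+ m * nome_pow (m * m.+1)%:R
                               * sinC ((2 * m + 1)%:R * piC * z))
        : nat -> C^o).

Definition thetabar_term (z : C) (m : int) : C :=
  expC (piC * iC * m%:~R ^+ 2 * tau + 2 * piC * iC * m%:~R * z).

(* The sum over all integers, as the sum over m >= 0 plus the sum over m < 0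
   ([Negz m] is - (m + 1)). *)
Definition thetabar (z : C) : C :=
  limn (series (fun m : nat => thetabar_term z (Posz m)) : nat -> C^o) +
  limn (series (fun m : nat => thetabar_term z (Negz m)) : nat -> C^o).

Definition kronecker (u x : C) : C :=
  derive1 (theta : C -> C^o) 0 * theta (u + x) / (theta u * theta x).

Definition lattice : set C :=
  [set z | exists a b : int, z = a%:~R + b%:~R * tau].

End Theta.

Section Tensors.
Variables (K : comNzRingType) (n : nat).

(* Mat_n (x) Mat_n is represented by 'M_(n * n), with the Kronecker product
   X *t Y as the tensor X (x) Y.  [map_of_tensor] is the linear isomorphism
   determined by X (x) Y |-> (Z |-> tr (X Z) Y), and [tensor_of_map] is its
   inverse; see the lemmas below. *)
Definition map_of_tensor (T : 'M[K]_(n * n)) (Z : 'M[K]_n) : 'M[K]_n :=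
  \matrix_(c, d)
    \sum_a \sum_b T (mxtens_index (a, c)) (mxtens_index (b, d)) * Z b a.

Definition tensor_of_map (f : 'M[K]_n -> 'M[K]_n) : 'M[K]_(n * n) :=
  \sum_(a < n) \sum_(b < n) delta_mx b a *t f (delta_mx a b).

Lemma map_of_tensor_pure (X Y Z : 'M[K]_n) :
  map_of_tensor (X *t Y) Z = \tr (X *m Z) *: Y.
Proof.
apply/matrixP => c d; rewrite !mxE /mxtrace big_distrl /=.
apply: eq_bigr => a _; rewrite mxE big_distrl /=.
by apply: eq_bigr => b _; rewrite tensmxE mulrAC.
Qed.

Lemma map_of_tensor_linearl (a : K) (S T : 'M[K]_(n * n)) (Z : 'M[K]_n) :
  map_of_tensor (a *: S + T) Z = a *: map_of_tensor S Z + map_of_tensor T Z.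
Proof.
apply/matrixP => c d; rewrite !mxE mulr_sumr -big_split /=.
apply: eq_bigr => i _; rewrite mulr_sumr -big_split /=.
by apply: eq_bigr => j _; rewrite !mxE mulrDl mulrA.
Qed.

Lemma map_of_tensor_linearr (T : 'M[K]_(n * n)) : linear (map_of_tensor T).
Proof.
move=> a Y Z; apply/matrixP => c d; rewrite !mxE mulr_sumr -big_split /=.
apply: eq_bigr => i _; rewrite mulr_sumr -big_split /=.
by apply: eq_bigr => j _; rewrite !mxE mulrDr mulrCA.
Qed.

Lemma map_of_tensorK : cancel map_of_tensor tensor_of_map.
Proof.
move=> T; apply/matrixP => i j.
case: (mxtens_indexP i) => a c; case: (mxtens_indexP j) => b d.
rewrite /tensor_of_map !summxE (bigD1 b) //= [X in _ + X]big1 ?addr0; last first.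
  move=> b' nb; rewrite summxE big1 // => a' _.
  by rewrite tensmxE mxE (eq_sym b) (negPf nb) andbF mul0r.
rewrite summxE (bigD1 a) //= [X in _ + X]big1 ?addr0; last first.
  by move=> a' na; rewrite tensmxE mxE (eq_sym a) (negPf na) mul0r.
rewrite tensmxE !mxE !eqxx mul1r (bigD1 a) //= [X in _ + X]big1 ?addr0; last first.
  by move=> a' na; rewrite big1 // => b' _; rewrite mxE (negPf na) andbF mulr0.
rewrite (bigD1 b) //= [X in _ + X]big1 ?addr0; last first.
  by move=> b' nb; rewrite mxE (negPf nb) mulr0.
by rewrite mxE !eqxx mulr1.
Qed.

Lemma tensor_of_mapK (f : {linear 'M[K]_n -> 'M[K]_n}) :
  map_of_tensor (tensor_of_map f) =1 f.
Proof.
move=> Z; rewrite [in RHS](matrix_sum_delta Z) linear_sum.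
have mD S T : map_of_tensor (S + T) Z = map_of_tensor S Z + map_of_tensor T Z.
  by have := map_of_tensor_linearl 1 S T Z; rewrite !scale1r.
have m0 : map_of_tensor 0 Z = 0.
  by apply: (addrI (map_of_tensor 0 Z)); rewrite -mD !addr0.
rewrite /tensor_of_map (big_morph (map_of_tensor ^~ Z) mD m0).
apply: eq_bigr => a _; rewrite linear_sum (big_morph (map_of_tensor ^~ Z) mD m0).
apply: eq_bigr => b _; rewrite map_of_tensor_pure linearZ; congr (_ *: _).
rewrite /mxtrace (bigD1 b) //= [X in _ + X]big1 ?addr0; last first.
  by move=> i ni; rewrite mxE big1 // => j _; rewrite mxE (negPf ni) mul0r.
rewrite mxE (bigD1 a) //= [X in _ + X]big1 ?addr0; last first.
  by move=> i ni; rewrite mxE (negPf ni) andbF mul0r.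
by rewrite mxE !eqxx mul1r.
Qed.

End Tensors.

Section Construction.
Variables (R : realType) (n : nat) (tau : R[i]) (B : 'M[R[i]]_n).
Local Notation C := (R[i]).

Definition Sigma : set C :=
  [set z | exists l l' w : C,
    [/\ eigenvalue B (expC (2 * piC * iC * l)),
        eigenvalue B (expC (2 * piC * iC * l')),
        lattice tau w & z = l - l' + w]].

Definition efactor (v z : C) : C := - expC (- (2 * piC * iC * (z + v + tau))).

(* Holomorphic on the whole complex plane: complex differentiable everywhere,
   entry by entry. *)
Definition holomorphic_mx (Phi : C -> 'M[C]_n) : Prop :=
  forall (k l : 'I_n) (z : C), derivable ((fun w => Phi w k l) : C^o -> C^o) z 1.

Definition Sol (v : C) : set (C -> 'M[C]_n) :=
  [set Phi | [/\ holomorphic_mx Phi,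
                 forall z, Phi (z + 1) = Phi z
               & forall z, Phi (z + tau) *m B = efactor v z *: (B *m Phi z)]].

(* This is the value Phi 0, not the residue at 0 of
   y |-> (thetabar (y + (tau + 1) / 2))^-1 *: Phi y, from which it differs by
   the factor thetabar' ((tau + 1) / 2); that factor therefore appears in
   closed formulas for [rB]. *)
Definition res0 (Phi : C -> 'M[C]_n) : 'M[C]_n := Phi 0.

(* The preimage under [res0] in [Sol v], which exists and is unique when B is
   invertible and v is not in [Sigma]; an unspecified function otherwise. *)
Definition res0_inv (v : C) (Z : 'M[C]_n) : C -> 'M[C]_n :=
  xget (fun=> 0) [set Phi | Sol v Phi /\ res0 Phi = Z].

Definition ev (y : C) (Phi : C -> 'M[C]_n) : 'M[C]_n :=
  (thetabar tau (y + (tau + 1) / 2))^-1 *: Phi y.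

Definition rtilde (v y : C) (Z : 'M[C]_n) : 'M[C]_n := ev y (res0_inv v Z).

Definition rB (v y : C) : 'M[C]_(n * n) := tensor_of_map (rtilde v y).

End Construction.

(* Main.v *)
Require Import Defs.
From mathcomp Require Import all_boot all_order all_algebra.
From mathcomp Require Import complex mxtens.
From mathcomp Require Import all_classical all_reals all_analysis.
From mathcomp Require Import ring lra zify.
Import Order.TTheory GRing.Theory Num.Theory.
Import numFieldNormedType.Exports.
Set Implicit Arguments.
Unset Strict Implicit.
Unset Printing Implicit Defensive.
Local Open Scope classical_set_scope.
Local Open Scope complex_scope.
Local Open Scope ring_scope.

(** The equation defining Sol decouples for diagonal B. With
    u = v - (lambda_k - lambda_l), the entry f = Phi_kl of a solution is an entire
    function with f(z + 1) = f(z) and f(z + tau) = - e(-(z + u + tau)) f(z), where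
    e(z) = exp(2 pi i z). One such function is G(z + u), where
    G(z) = thetabar(z + (tau + 1) / 2). Hence the solution with Phi(0) = Z has
    entries Z_kl G(z + u) / G(u), provided that these functions are the only
    solutions and that G(u) is nonzero. Dividing by G(y) = thetabar(y + (tau+1)/2)
    and using theta(z) = const * exp(pi i z) G(z), in which the exponentials of the
    three arguments u, y, u + y cancel, gives the Kronecker function divided by
    G'(0), which is the derivative of thetabar at (tau + 1) / 2; here one needs that
    this derivative is nonzero.

    Uniqueness ([quasi_periodic_uniq]) rests on Fourier coefficients. Goursat's
    lemma for parallelograms ([boundary_integral_eq0]) shows that the coefficients of f on the
    line through w are those on the real line times e(mw). The quasi-period then
    becomes a two-term recursion, so all coefficients are determined by the zeroth
    one. An entire periodic function whose coefficients all vanish is zero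
    ([fourier_eq0]), by Chernoff's argument and Bessel's inequality. So the
    solutions form a space of dimension at most 1.

    The zeros of G come from Jacobi's triple product. Its finite form
    ([finite_triple_product]) is an algebraic identity, and Tannery's theorem lets
    the number of factors tend to infinity ([triple_product_cvg]). Only a lower
    bound is needed: |G(z)| >= delta |1 - e(-z)| for |Im z| <= Im tau / 2
    ([theta_shift_lower]). It yields both that G vanishes only on the lattice and
    that G'(0) is nonzero.

    Complex derivatives and limits are handled through inequalities between real
    numbers, and integrals are taken over [0, 1], by means of primitives. *)

Notation cmod := Normc.normc.

(** * The real-valued modulus of a complex number *)

Section Modulus.
Variable R : realType.
Local Notation C := R[i].
Implicit Types (z w : C) (x e : R).

Lemma normCE z : `|z| = (cmod z)%:C. Proof. by []. Qed.

Lemma cmod_ge0 z : 0 <= cmod z.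
Proof. by case: z => a b; exact: sqrtr_ge0. Qed.

Lemma cmod0 : cmod (0 : C) = 0.
Proof. exact: Normc.normc0. Qed.

Lemma cmod1 : cmod (1 : C) = 1.
Proof. exact: Normc.normc1. Qed.

Lemma cmod_eq0 z : (cmod z == 0) = (z == 0).
Proof. by apply/eqP/eqP => [/Normc.eq0_normc|->]; rewrite ?cmod0. Qed.

Lemma cmod_gt0 z : (0 < cmod z) = (z != 0).
Proof. by rewrite lt0r cmod_ge0 andbT cmod_eq0. Qed.

Lemma cmodM z w : cmod (z * w) = cmod z * cmod w.
Proof. exact: Normc.normcM. Qed.

Lemma cmodV z : cmod z^-1 = (cmod z)^-1.
Proof. exact: Normc.normcV. Qed.

Lemma cmodN z : cmod (- z) = cmod z.
Proof. exact: normcN. Qed.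

Lemma cmodD z w : cmod (z + w) <= cmod z + cmod w.
Proof. exact: le_normcD. Qed.

Lemma cmodB z w : cmod (z - w) <= cmod z + cmod w.
Proof. by rewrite (le_trans (cmodD _ _))// cmodN. Qed.

Lemma cmodBC z w : cmod (z - w) = cmod (w - z).
Proof. by rewrite -cmodN opprB. Qed.

Lemma cmodX z m : cmod (z ^+ m) = cmod z ^+ m.
Proof. by elim: m => [|m IH]; rewrite ?expr0 ?cmod1// !exprS cmodM IH. Qed.

Lemma cmodR x : cmod (x%:C) = `|x|.
Proof. by rewrite /= expr0n /= addr0 sqrtr_sqr. Qed.

Lemma cmod_nat m : cmod (m%:R : C) = m%:R.
Proof. by rewrite -(rmorph_nat (real_complex R)) cmodR ger0_norm. Qed.

Lemma cmod_Re z : `|complex.Re z| <= cmod z.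
Proof.
case: z => a b /=; rewrite -sqrtr_sqr ler_sqrt; last by rewrite addr_ge0 ?sqr_ge0.
by rewrite lerDl sqr_ge0.
Qed.

Lemma cmod_Im z : `|complex.Im z| <= cmod z.
Proof.
case: z => a b /=; rewrite -sqrtr_sqr ler_sqrt; last by rewrite addr_ge0 ?sqr_ge0.
by rewrite lerDr sqr_ge0.
Qed.

Lemma cmod_i x : cmod (x *i) = `|x|.
Proof. by rewrite /= expr0n /= add0r sqrtr_sqr. Qed.

Lemma cmod_le_ReIm z : cmod z <= `|complex.Re z| + `|complex.Im z|.
Proof.
case: z => a b; have -> : a +i* b = a%:C + b *i by simpc.
by rewrite (le_trans (cmodD _ _))// cmodR cmod_i /= addr0 add0r.
Qed.

Lemma cmod_sum (I : Type) (r : seq I) (P : pred I) (F : I -> C) :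
  cmod (\sum_(i <- r | P i) F i) <= \sum_(i <- r | P i) cmod (F i).
Proof.
elim/big_rec2: _ => [|i y x _ h]; first by rewrite cmod0.
by rewrite (le_trans (cmodD _ _))// lerD2l.
Qed.

Lemma cmod_prod (I : Type) (r : seq I) (P : pred I) (F : I -> C) :
  cmod (\prod_(i <- r | P i) F i) = \prod_(i <- r | P i) cmod (F i).
Proof.
by elim/big_rec2: _ => [|i y x _ <-]; rewrite ?cmod1// cmodM.
Qed.

Lemma cmod_ge_sub z w : cmod z - cmod w <= cmod (z - w).
Proof. by rewrite lerBlDr -{1}(subrK w z) cmodD. Qed.

End Modulus.

(** * Limits and absolutely convergent series of complex numbers *)

Section Limits.
Variable R : realType.
Local Notation C := R[i].

Definition clim (u : nat -> C) (l : C) := forall e : R, 0 < e ->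
  exists N, forall m, (N <= m)%N -> cmod (u m - l) < e.

(** The two notions agree because the norm of [R[i]] is [cmod] embedded in
    [R[i]]; the epsilon form keeps all inequalities between real numbers,
    where linear arithmetic applies. *)
Lemma climP (u : nat -> C) (l : C) :
  (u : nat -> C^o) @ \oo --> (l : C^o) <-> clim u l.
Proof.
split=> [/cvgrPdist_lt ul e e0|ul].
  have /ul[N _ uN] : 0 < e%:C by rewrite ltcR.
  by exists N => m Nm; have := uN m Nm; rewrite normCE ltcR cmodBC.
apply/cvgrPdist_lt => e; rewrite ltcE /= => /andP[/eqP e0i e0].
have [N uN] := ul _ e0; exists N => // m Nm /=.
by rewrite normCE ltcE /= e0i eqxx cmodBC uN.
Qed.

Lemma clim_lim (u : nat -> C) (l : C) :
  clim u l -> limn (u : nat -> C^o) = l.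
Proof. by move/climP => /cvg_lim; apply. Qed.

Lemma clim_uniq (u : nat -> C) (l l' : C) : clim u l -> clim u l' -> l = l'.
Proof. by move=> /clim_lim <- /clim_lim <-. Qed.

Lemma clim_cst (l : C) : clim (fun=> l) l.
Proof. by move=> e e0; exists 0%N => m _; rewrite subrr cmod0. Qed.

Lemma climD (u v : nat -> C) (l k : C) :
  clim u l -> clim v k -> clim (fun m => u m + v m) (l + k).
Proof.
move=> /climP ul /climP vk; apply/climP.
exact: (@cvgD R[i] (R[i])^o nat \oo _ u v l k ul vk).
Qed.

Lemma climM (u v : nat -> C) (l k : C) :
  clim u l -> clim v k -> clim (fun m => u m * v m) (l * k).
Proof.
move=> /climP ul /climP vk; apply/climP.
exact: (@cvgM R[i] nat \oo _ u v l k ul vk).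
Qed.

Lemma climV (u : nat -> C) (l : C) :
  l != 0 -> clim u l -> clim (fun m => (u m)^-1) l^-1.
Proof. by move=> l0 /climP ul; apply/climP; apply: cvgV. Qed.

Lemma clim_ext (u v : nat -> C) (l : C) : u =1 v -> clim u l -> clim v l.
Proof. by move=> /funext ->. Qed.

Lemma clim_sub (u : nat -> C) (l : C) (s : nat -> nat) :
  (forall m, (m <= s m)%N) -> clim u l -> clim (fun m => u (s m)) l.
Proof.
move=> sm ul e /ul[N uN]; exists N => m Nm; apply: uN.
exact: leq_trans (sm m).
Qed.

Lemma clim_cmod_le (u : nat -> C) (l : C) (M : R) :
  clim u l -> (forall m, cmod (u m) <= M) -> cmod l <= M.
Proof.
move=> ul uM; apply/ler_addgt0Pr => e /ul[N /(_ N (leqnn N)) uN].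
have := cmod_ge_sub l (u N); rewrite cmodBC => h; have := uM N; lra.
Qed.

Lemma clim_cmod_ge (u : nat -> C) (l : C) (M : R) :
  clim u l -> (forall m, M <= cmod (u m)) -> M <= cmod l.
Proof.
move=> ul uM; apply/ler_addgt0Pr => e /ul[N /(_ N (leqnn N)) uN].
have := cmod_ge_sub (u N) l; have := uM N; lra.
Qed.

Definition csum (b : nat -> C) (m : nat) := \sum_(i < m) b i.

Lemma seriesE (b : nat -> C) : (series (b : nat -> C^o) : nat -> C) = csum b.
Proof. by apply/funext => m; rewrite /series /= /csum big_mkord. Qed.

Definition abs_summable (b : nat -> C) :=
  exists K : R, forall m, \sum_(i < m) cmod (b i) <= K.

Lemma real_abs_cvg (u : nat -> R) (K : R) :
  (forall m, \sum_(i < m) `|u i| <= K) -> exists l : R, (series u) @ \oo --> l.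
Proof.
move=> uK; exists (limn (series u)).
suff: cvgn (series u) by [].
apply: normed_cvg; apply: nondecreasing_is_cvgn.
  by apply: nondecreasing_series => i _ _ /=.
exists K => _ [m _ <-] /=; have := uK m.
by rewrite /series /= big_mkord.
Qed.

(** Completeness of the complex numbers is inherited from the reals: the series
    of real and of imaginary parts are dominated by the moduli. *)
Lemma abs_summable_cvg (b : nat -> C) : abs_summable b -> exists l, clim (csum b) l.
Proof.
move=> [K bK].
have [|l hl] := @real_abs_cvg (fun i => complex.Re (b i)) K.
  by move=> m; apply: le_trans (bK m); apply: ler_sum => i _; exact: cmod_Re.
have [|k hk] := @real_abs_cvg (fun i => complex.Im (b i)) K.
  by move=> m; apply: le_trans (bK m); apply: ler_sum => i _; exact: cmod_Im.
exists (l +i* k) => e e0; have e20 : 0 < e / 2 by rewrite divr_gt0.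
move/cvgrPdist_lt: hl => /(_ _ e20)[N1 _ h1].
move/cvgrPdist_lt: hk => /(_ _ e20)[N2 _ h2].
exists (maxn N1 N2) => m; rewrite geq_max => /andP[m1 m2].
apply: le_lt_trans (cmod_le_ReIm _) _.
have := h1 m m1; have := h2 m m2.
have ReS : complex.Re (csum b m) = series (fun i => complex.Re (b i)) m.
  rewrite /series /= big_mkord /csum; elim/big_rec2: _ => // i y x _ <-.
  by case: (b i) (x) => ? ? [].
have ImS : complex.Im (csum b m) = series (fun i => complex.Im (b i)) m.
  rewrite /series /= big_mkord /csum; elim/big_rec2: _ => // i y x _ <-.
  by case: (b i) (x) => ? ? [].
rewrite -ReS -ImS; case: (csum b m) => x y /=.
rewrite (distrC k) (distrC l); lra.
Qed.

Lemma abs_summable_cmod_lim (b : nat -> C) (K : R) l :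
  (forall m, \sum_(i < m) cmod (b i) <= K) -> clim (csum b) l -> cmod l <= K.
Proof.
move=> bK bl; apply: clim_cmod_le bl _ => m; apply: le_trans (bK m).
exact: cmod_sum.
Qed.

Lemma csumD (a b : nat -> C) m : csum (fun i => a i + b i) m = csum a m + csum b m.
Proof. exact: big_split. Qed.

Lemma csumZ c (b : nat -> C) m : csum (fun i => c * b i) m = c * csum b m.
Proof. by rewrite /csum mulr_sumr. Qed.

Lemma real_summable_tail (a : nat -> R) (K : R) : (forall i, 0 <= a i) ->
  (forall m, \sum_(i < m) a i <= K) -> forall e, 0 < e ->
  exists N, forall m, \sum_(N <= i < m) a i <= e.
Proof.
move=> a0 aK e e0.
have [|l hl] := @real_abs_cvg a K.
  move=> m; apply: le_trans (aK m); apply: ler_sum => i _.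
  by rewrite ger0_norm.
move/cvgrPdist_lt: (hl) => /(_ e e0)[N _ hN]; exists N => m.
have [Nm|mN] := leqP N m; last by rewrite big_geq ?(ltnW mN)// ltW.
have := hN N (leqnn N); rewrite /series /= => h.
have hm : \sum_(0 <= i < m) a i <= l.
  have /cvg_lim <- // := hl.
  apply: nondecreasing_cvgn_le; last by apply/cvg_ex; exists l.
  by apply: nondecreasing_series => i _ _.
have := big_cat_nat (leq0n N) Nm (op:=+%R) (idx:=0) (P:=xpredT) (F:=a).
move: h hm => /= h hm E.
move: hm; rewrite E ltr_norml in h * => hm.
case/andP: h; lra.
Qed.

End Limits.

(** * The complex exponential *)

Section Exp.
Variable R : realType.
Local Notation C := R[i].
Implicit Types (z w : C) (x y : R).

Lemma expCD z w : expC (z + w) = expC z * expC w.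
Proof.
case: z w => a b [c d]; rewrite /expC /= expRD cosD sinD; simpc.
by congr (_ +i* _); ring.
Qed.

Lemma expC0 : expC (0 : C) = 1.
Proof. by rewrite /expC /= expR0 cos0 sin0; simpc. Qed.

Lemma cmod_expC z : cmod (expC z) = expR (complex.Re z).
Proof.
rewrite /expC cmodM cmodR ger0_norm ?expR_ge0//=.
by rewrite cos2Dsin2 sqrtr1 mulr1.
Qed.

Lemma expC_neq0 z : expC z != 0.
Proof. by rewrite -cmod_gt0 cmod_expC expR_gt0. Qed.

Lemma expCN z : expC (- z) = (expC z)^-1.
Proof.
apply: (mulfI (expC_neq0 z)); rewrite -expCD subrr expC0 mulfV//.
exact: expC_neq0.
Qed.

Lemma expC_nat z m : expC (m%:R * z) = expC z ^+ m.
Proof.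
elim: m => [|m IH]; first by rewrite mul0r expC0 expr0.
by rewrite -natr1 mulrDl mul1r expCD IH exprSr.
Qed.

Lemma expC_int z (m : int) : expC (m%:~R * z) = expC z ^ m.
Proof.
case: m => m; first exact: expC_nat.
by rewrite NegzE rmorphN /= mulNr expCN -pmulrn expC_nat.
Qed.

(** The function e(z) = exp(2 pi i z), whose kernel is the group of integers. *)
Definition e2pi z : C := expC (2 * piC * iC * z).

Lemma e2pi1 : e2pi 1 = 1.
Proof.
rewrite /e2pi mulr1 /piC /iC; have -> : 2 * (pi : R)%:C * 'i%C = 0 +i* (pi *+ 2).
  by rewrite mulr2n; simpc; congr (_ +i* _); ring.
by rewrite /expC /= expR0 cos2pi sin2pi; simpc.
Qed.

Lemma e2piD z w : e2pi (z + w) = e2pi z * e2pi w.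
Proof. by rewrite /e2pi mulrDr expCD. Qed.

Lemma e2piN z : e2pi (- z) = (e2pi z)^-1.
Proof. by rewrite /e2pi mulrN expCN. Qed.

Lemma e2pi0 : e2pi 0 = 1.
Proof. by rewrite /e2pi mulr0 expC0. Qed.

Lemma e2pi_neq0 z : e2pi z != 0.
Proof. exact: expC_neq0. Qed.

Lemma e2pi_int (m : int) : e2pi m%:~R = 1.
Proof.
rewrite /e2pi mulrC expC_int -[X in expC X]mulr1.
by have := e2pi1; rewrite /e2pi => ->; rewrite exp1rz.
Qed.

Lemma e2piMn z m : e2pi (m%:R * z) = e2pi z ^+ m.
Proof. by rewrite /e2pi mulrCA expC_nat. Qed.

Lemma cmod_e2pi z : cmod (e2pi z) = expR (- (2 * pi * complex.Im z)).
Proof.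
rewrite /e2pi cmod_expC; congr expR; case: z => a b; rewrite /piC /iC; simpc.
by rewrite /=; ring.
Qed.

(** The modulus forces z to be real; the real part modulo 1 is then a number in
    [0, 1) whose half-angle sine sin(pi y) vanishes. *)
Lemma e2pi_eq1 z : e2pi z = 1 -> exists m : int, z = m%:~R.
Proof.
case: z => a b h; have h1 := cmod_e2pi (a +i* b).
have b0 : b = 0.
  have /expR_inj h0 : expR 0 = expR (- (2 * pi * b)).
    by rewrite expR0 -[b]/(complex.Im (a +i* b)) -h1 h cmod1.
  apply: (mulfI (lt0r_neq0 (pi_gt0 R))); rewrite mulr0; lra.
exists (Num.floor a).
suff E : a = (Num.floor a)%:~R.
  by rewrite b0 complexr0 {1}E rmorph_int.
have hs : e2pi ((a - (Num.floor a)%:~R)%:C) = 1.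
  have -> : ((a - (Num.floor a)%:~R)%:C) = (a +i* b) - ((Num.floor a)%:~R : C).
    by rewrite b0 rmorphB /= rmorph_int.
  by rewrite e2piD h e2piN e2pi_int invr1 mulr1.
have f1 := floor_le a; have f2 := floorD1_gt a.
move: hs f1 f2; set s := _%:~R => hs f1 f2.
have {}f2 : a - s < 1 by move: f2; rewrite -/s intrD -/s; lra.
have {}f1 : 0 <= a - s by lra.
suff : a - s = 0 by lra.
move: (a - s) f1 f2 hs => y y0 y1.
rewrite /e2pi /expC /piC /iC; simpc => -[].
have -> : (1 + 1) * pi * y = (pi * y) *+ 2 :> R by ring.
rewrite expR0 mul1r cos_mulr2n => hc _.
have s0 : sin (pi * y) = 0.
  by apply/eqP; rewrite -sqrf_eq0 sin2cos2; apply/eqP; lra.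
apply/eqP; apply: contraT => yn0.
have p0 := pi_gt0 R; have ygt : 0 < y by rewrite lt0r yn0.
have : 0 < sin (pi * y).
  by apply: sin_gt0_pi; rewrite mulr_gt0//= gtr_pMr.
by rewrite s0 ltxx.
Qed.

Lemma expC_pi1 : expC (piC * iC : C) = -1.
Proof.
rewrite /expC /piC /iC; simpc; rewrite /= expR0 cospi sinpi; simpc.
by [].
Qed.

Lemma norm_sin_le y : `|sin y| <= `|y|.
Proof.
wlog y0 : y / 0 <= y.
  move=> h; have [/h//|/ltW y0] := leP 0 y.
  by rewrite -normrN -sinN -(normrN y); apply: h; lra.
have [->|yn0] := eqVneq y 0; first by rewrite sin0.
have y1 : 0 < y by rewrite lt0r yn0.
have [|c _] := MVT y1 (f := sin) (df := cos) (fun x _ => is_derive_sin x).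
  exact/continuous_subspaceT/continuous_sin.
by rewrite sin0 !subr0 => ->; rewrite normrM ler_piMl// cos_max.
Qed.

Lemma cos_taylor y : 0 <= 1 - cos y <= y ^+ 2.
Proof.
rewrite subr_ge0 cos_le1 /=.
have -> : y = (y / 2) *+ 2 by rewrite -mulr_natr divfK.
rewrite cos_mulr2n; have := sin2cos2 (y / 2).
have : sin (y / 2) ^+ 2 <= (y / 2) ^+ 2.
  by rewrite -(real_normK (num_real (sin _))) -(real_normK (num_real (y / 2)))
    ler_sqr ?nnegrE ?norm_sin_le.
move=> h1 h2; have h3 := sqr_ge0 (y / 2).
have -> : (y / 2 *+ 2) ^+ 2 = 4 * (y / 2) ^+ 2 by ring.
lra.
Qed.

Lemma sin_taylor y : `|sin y - y| <= 2 * y ^+ 2.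
Proof.
wlog y0 : y / 0 <= y.
  move=> h; have [/h//|/ltW y0] := leP 0 y.
  have := h (- y); rewrite sinN sqrrN -opprD normrN; apply; lra.
have [->|yn0] := eqVneq y 0; first by rewrite sin0 subrr normr0 mulr_ge0 ?sqr_ge0.
have y1 : 0 < y by rewrite lt0r yn0.
have [|c] := MVT y1 (f := sin) (df := cos) (fun x _ => is_derive_sin x).
  exact/continuous_subspaceT/continuous_sin.
rewrite in_itv /= => /andP[c0 cy]; rewrite sin0 !subr0 => ->.
have hc : `|cos c - 1| <= 2 * y.
  have /andP[k1 k2] := cos_taylor c; have := cos_geN1 c.
  rewrite ler0_norm; last lra.
  by move=> k3; have [c1|c1] := leP c 1; nra.
rewrite -{2}[y]mul1r -mulrBl normrM (ger0_norm y0).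
have -> : 2 * y ^+ 2 = 2 * y * y by ring.
by rewrite ler_wpM2r.
Qed.

Lemma expR_taylor x : 0 <= expR x - 1 - x <= x ^+ 2 * expR `|x|.
Proof.
have h1 := expR_ge1Dx x; have h2 := expR_ge1Dx (- x).
have ep := expR_gt0 x.
have h3 : expR x - 1 <= x * expR x.
  by rewrite expRN in h2; have := ler_wpM2r (ltW ep) h2; rewrite mulVf ?gt_eqF//; lra.
apply/andP; split; first lra.
have [x0|x0] := leP 0 x.
  rewrite ger0_norm//; nra.
have e1 : 1 <= expR `|x| by rewrite -expR0 ler_expR.
have : x ^+ 2 <= x ^+ 2 * expR `|x| by rewrite ler_peMr// sqr_ge0.
have : expR x <= 1 by rewrite -expR0 ler_expR ltW.
nra.
Qed.
End Exp.

(** * Complex derivatives *)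

Section Derivative.
Variable R : realType.
Local Notation C := R[i].
Implicit Types (z w d : C) (x y : R) (f g : C -> C).

(** The derivative as an inequality with a real error term. Unlike the limit of
    difference quotients, it needs no division by the increment. *)
Definition has_cderiv f z d := forall e : R, 0 < e -> exists2 r : R, 0 < r &
  forall h, cmod h < r -> cmod (f (z + h) - f z - d * h) <= e * cmod h.

Lemma has_cderiv_lib f z d : has_cderiv f z d <-> @is_derive C C^o C^o z 1 f d.
Proof.
split=> [fd|[fdr fE]].
  have key : (fun h : C^o => h^-1 *: ((f (h *: (1 : C^o) + z) : C^o) - f z))
      @ (0 : C^o)^' --> (d : C^o).
    apply/cvgrPdist_le => e; rewrite ltcE /= => /andP[/eqP e0i e0].
    have [r r0 fr] := fd _ e0.
    exists (r%:C) => /=; first by rewrite ltcR.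
    move=> h /=; rewrite sub0r normrN normCE ltcR => hr h0.
    rewrite normCE lecE /= e0i eqxx /=.
    have -> : d - h^-1 *: ((f (h *: (1 : C^o) + z) : C^o) - f z) =
        - (h^-1 * (f (z + h) - f z - d * h)).
      rewrite /GRing.scale /= mulr1 (addrC h) [in RHS]mulrBr [_ * (d * h)]mulrCA.
      by rewrite mulVf ?mulr1 ?opprB.
    rewrite cmodN cmodM cmodV mulrC ler_pdivrMr ?cmod_gt0//; exact: fr.
  split; first by apply/cvg_ex; exists d.
  by rewrite /derive; apply: cvg_lim => //.
move=> e e0.
have : (fun h : C^o => h^-1 *: ((f (h *: (1 : C^o) + z) : C^o) - f z))
      @ (0 : C^o)^' --> (d : C^o).
  by rewrite -fE /derive; exact: fdr.
move/cvgrPdist_le => /(_ e%:C); rewrite ltcR => /(_ e0)[r /=].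
rewrite ltcE /= => /andP[/eqP r0i r0] fr.
exists (complex.Re r) => // h hr.
have [->|h0] := eqVneq h 0; first by rewrite addr0 mulr0 !subr0 subrr cmod0 mulr0.
have /= := fr h; rewrite sub0r normrN normCE ltcE /= r0i eqxx => /(_ hr h0).
rewrite normCE lecR.
have -> : d - h^-1 *: ((f (h *: (1 : C^o) + z) : C^o) - f z) =
    - (h^-1 * (f (z + h) - f z - d * h)).
  rewrite /GRing.scale /= mulr1 (addrC h) [in RHS]mulrBr [_ * (d * h)]mulrCA.
  by rewrite mulVf ?mulr1 ?opprB.
by rewrite cmodN cmodM cmodV mulrC ler_pdivrMr ?cmod_gt0.
Qed.

(** Transfers holomorphy, given by limits of difference quotients, to the
    inequality form and back. *)
Lemma derivable_has_cderiv f z :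
  derivable (f : C^o -> C^o) z 1 <-> exists d, has_cderiv f z d.
Proof.
split=> [fd|[d /has_cderiv_lib[]]//]; exists ('D_1 (f : C^o -> C^o) z).
by apply/has_cderiv_lib; split.
Qed.

Lemma has_cderiv_derive1 f z d : has_cderiv f z d -> derive1 (f : C -> C^o) z = d.
Proof. by move/has_cderiv_lib => [_ <-]; rewrite derive1E. Qed.

Lemma has_cderivM f g z d d' : has_cderiv f z d -> has_cderiv g z d' ->
  has_cderiv (fun w => f w * g w) z (d * g z + f z * d').
Proof.
move=> fd gd.
have := @is_deriveM R[i] (R[i])^o f g z 1 d d'
  ((has_cderiv_lib _ _ _).1 fd) ((has_cderiv_lib _ _ _).1 gd).
rewrite /GRing.scale /= addrC [g z * d]mulrC => H.
exact: ((has_cderiv_lib (fun w => f w * g w) z _).2 H).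
Qed.

Lemma has_cderivZ f z d (c : C) : has_cderiv f z d ->
  has_cderiv (fun w => c * f w) z (c * d).
Proof.
move=> fd e e0; have c1 : 0 < cmod c + 1 by rewrite ltr_wpDl ?cmod_ge0.
have [r r0 fr] := fd _ (divr_gt0 e0 c1).
exists r => // h /fr hr.
have -> : c * f (z + h) - c * f z - c * d * h = c * (f (z + h) - f z - d * h).
  by ring.
rewrite cmodM (le_trans (ler_wpM2l (cmod_ge0 _) hr))// mulrA.
rewrite ler_wpM2r ?cmod_ge0// mulrCA ler_piMr ?(ltW e0)// ler_pdivrMr//.
by rewrite mul1r lerDl.
Qed.

Lemma has_cderivD f g z d d' : has_cderiv f z d -> has_cderiv g z d' ->
  has_cderiv (fun w => f w + g w) z (d + d').
Proof.
move=> fd gd e e0; have e20 : 0 < e / 2 by rewrite divr_gt0.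
have [r r0 fr] := fd _ e20; have [s s0 gs] := gd _ e20.
exists (Num.min r s); first by rewrite lt_min r0.
move=> h; rewrite lt_min => /andP[/fr hr /gs hs].
have -> : f (z + h) + g (z + h) - (f z + g z) - (d + d') * h =
  (f (z + h) - f z - d * h) + (g (z + h) - g z - d' * h) by ring.
by rewrite (le_trans (cmodD _ _))//; lra.
Qed.

Lemma has_cderiv_shift f z w d : has_cderiv f (z + w) d ->
  has_cderiv (fun u => f (u + w)) z d.
Proof.
move=> fd e e0; have [r r0 fr] := fd e e0.
by exists r => // h /fr; rewrite (addrAC z w).
Qed.

Lemma has_cderiv_cont f z d : has_cderiv f z d -> forall e : R, 0 < e ->
  exists2 r : R, 0 < r & forall h, cmod h < r -> cmod (f (z + h) - f z) < e.
Proof.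
move=> fd e e0; have [r r0 fr] := fd 1 ltr01.
have c1 : 0 < cmod d + 1 by rewrite ltr_wpDl ?cmod_ge0.
exists (Num.min r (e / (cmod d + 1))); first by rewrite lt_min r0 divr_gt0.
move=> h; rewrite lt_min ltr_pdivlMr// => /andP[/fr hr he].
have := cmod_ge_sub (f (z + h) - f z) (d * h); rewrite cmodM; lra.
Qed.

Definition entire f := forall z, exists d, has_cderiv f z d.

Lemma entireM f g : entire f -> entire g -> entire (fun w => f w * g w).
Proof.
move=> fe ge z; have [d fd] := fe z; have [d' gd] := ge z.
by eexists; exact: has_cderivM fd gd.
Qed.

Lemma entireD f g : entire f -> entire g -> entire (fun w => f w + g w).
Proof.
move=> fe ge z; have [d fd] := fe z; have [d' gd] := ge z.
by eexists; exact: has_cderivD fd gd.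
Qed.

Lemma entireZ f (c : C) : entire f -> entire (fun w => c * f w).
Proof. by move=> fe z; have [d fd] := fe z; eexists; exact: has_cderivZ fd. Qed.

Lemma entire_shift f w : entire f -> entire (fun u => f (u + w)).
Proof.
by move=> fe z; have [d fd] := fe (z + w); eexists; exact: has_cderiv_shift fd.
Qed.

End Derivative.

(** * Series of exponentials define entire functions *)

Section ExpSeries.
Variable R : realType.
Local Notation C := R[i].
Implicit Types (z w d : C) (x y : R) (f g : C -> C).

(** The quadratic remainder bound from which termwise differentiation of a
    series of exponentials follows. *)
Lemma expC_taylor w : cmod (expC w - 1 - w) <= 6 * cmod w ^+ 2 * expR (cmod w).
Proof.
case: w => x y; set r := cmod (x +i* y).
have xr : `|x| <= r := cmod_Re (x +i* y).
have yr : `|y| <= r := cmod_Im (x +i* y).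
have r0 : 0 <= r := cmod_ge0 _.
have e1 : 1 + r <= expR r := expR_ge1Dx r.
apply: le_trans (cmod_le_ReIm _) _; rewrite /expC; simpc => /=.
have /andP[t1 t2] := expR_taylor x; have /andP[c1 c2] := cos_taylor y.
have s2 := sin_taylor y; have cm := cos_max y; have sm := sin_max y.
have er : expR `|x| <= expR r by rewrite ler_expR.
have q1 : x ^+ 2 <= r ^+ 2 by rewrite -real_normK ?num_real// ler_sqr ?nnegrE.
have q2 : y ^+ 2 <= r ^+ 2 by rewrite -real_normK ?num_real// ler_sqr ?nnegrE.
have t3 : expR x - 1 - x <= r ^+ 2 * expR r.
  by rewrite (le_trans t2)// ler_pM ?sqr_ge0 ?expR_ge0.
have ->: expR x * cos y - 1 - x = (expR x - 1 - x) * cos y - (1 + x) * (1 - cos y).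
  by ring.
have -> : expR x * sin y - y =
  (expR x - 1 - x) * sin y + (1 + x) * (sin y - y) + x * y by ring.
have x1 : `|1 + x| <= expR r.
  by rewrite (le_trans (ler_normD _ _))// normr1; lra.
have a1 : `|(expR x - 1 - x) * cos y| <= r ^+ 2 * expR r.
  rewrite normrM (ger0_norm t1) (le_trans _ t3)// ler_piMr//.
have a2 : `|(1 + x) * (1 - cos y)| <= expR r * r ^+ 2.
  by rewrite normrM (ger0_norm c1) ler_pM// (le_trans c2).
have a3 : `|(expR x - 1 - x) * sin y| <= r ^+ 2 * expR r.
  rewrite normrM (ger0_norm t1) (le_trans _ t3)// ler_piMr//.
have a4 : `|(1 + x) * (sin y - y)| <= expR r * (2 * r ^+ 2).
  by rewrite normrM ler_pM// (le_trans s2)//; lra.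
have a5 : `|x * y| <= r ^+ 2 * expR r.
  have : `|x * y| <= r ^+ 2 by rewrite normrM expr2 ler_pM.
  move=> /le_trans; apply; rewrite ler_peMr ?sqr_ge0//; lra.
have b1 := ler_normB ((expR x - 1 - x) * cos y) ((1 + x) * (1 - cos y)).
have b2 := ler_normD ((expR x - 1 - x) * sin y + (1 + x) * (sin y - y)) (x * y).
have b3 := ler_normD ((expR x - 1 - x) * sin y) ((1 + x) * (sin y - y)).
lra.
Qed.

Lemma has_cderiv_expC z (b : C) :
  has_cderiv (fun w => expC (b * w)) z (b * expC (b * z)).
Proof.
move=> e e0; set M := cmod (expC (b * z)) * (6 * cmod b ^+ 2 * expR (cmod b)).
have M0 : 0 <= M by rewrite !mulr_ge0 ?cmod_ge0 ?expR_ge0.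
exists (Num.min 1 (e / (M + 1))).
  by rewrite lt_min ltr01 divr_gt0// ltr_wpDl.
move=> h; rewrite lt_min => /andP[h1].
rewrite ltr_pdivlMr ?ltr_wpDl// => h2; have h0 := cmod_ge0 h.
have -> : expC (b * (z + h)) - expC (b * z) - b * expC (b * z) * h =
  expC (b * z) * (expC (b * h) - 1 - b * h) by rewrite mulrDr expCD; ring.
suff : cmod (expC (b * z) * (expC (b * h) - 1 - b * h)) <= M * cmod h ^+ 2.
  by move=> /le_trans; apply; rewrite expr2; nra.
rewrite cmodM /M -mulrA ler_wpM2l ?cmod_ge0// (le_trans (expC_taylor _))//.
have -> : 6 * cmod b ^+ 2 * expR (cmod b) * cmod h ^+ 2 =
  6 * (cmod b * cmod h) ^+ 2 * expR (cmod b) by ring.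
rewrite cmodM; apply: ler_wpM2l; first by rewrite mulr_ge0 ?sqr_ge0.
by rewrite ler_expR ler_piMr ?cmod_ge0// ltW.
Qed.

Lemma entire_e2pi (m : int) : entire (fun z : C => e2pi (m%:~R * z)).
Proof.
move=> z; exists (2 * piC * iC * m%:~R * expC (2 * piC * iC * m%:~R * z)).
have -> : (fun z : C => e2pi (m%:~R * z)) =
  (fun z => expC (2 * piC * iC * m%:~R * z)).
  by apply/funext => w; rewrite /e2pi mulrA.
exact: has_cderiv_expC.
Qed.

Lemma cmod_expC_le z : cmod (expC z) <= expR (cmod z).
Proof.
by rewrite cmod_expC ler_expR (le_trans _ (cmod_Re z))// ler_norm.
Qed.

(** Convergence of sum |a_i| exp(r |b_i|) for every real r: the condition under
    which sum a_i exp(b_i z), its termwise derivative and the Taylor remainders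
    all converge absolutely at every z. *)
Definition superexp (a b : nat -> C) := forall r : R, exists K : R, forall m,
  \sum_(i < m) cmod (a i) * expR (r * cmod (b i)) <= K.

Lemma superexp_summable a b z : superexp a b ->
  abs_summable (fun i => a i * expC (b i * z)).
Proof.
move=> /(_ (cmod z))[K ab]; exists K => m; apply: le_trans (ab m).
apply: ler_sum => i _; rewrite cmodM ler_wpM2l ?cmod_ge0//.
by rewrite (le_trans (cmod_expC_le _))// cmodM mulrC.
Qed.

Lemma le_expRx x : x <= expR x.
Proof. have := expR_ge1Dx x; lra. Qed.

(** Termwise differentiation. By [expC_taylor] the remainder of the i-th term is
    at most 6 |h|^2 |a_i| exp((|z| + 3) |b_i|) when |h| <= 1, and these bounds are
    summable. *)
Lemma exp_series_entire (a b : nat -> C) (S : C -> C) : superexp a b ->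
  (forall z, clim (csum (fun i => a i * expC (b i * z))) (S z)) -> entire S.
Proof.
move=> ab hS z.
have sD : abs_summable (fun i => a i * b i * expC (b i * z)).
  have [K hK] := ab (cmod z + 1); exists K => m; apply: le_trans (hK m).
  apply: ler_sum => i _; rewrite 2!cmodM -mulrA ler_wpM2l ?cmod_ge0//.
  rewrite mulrDl mul1r expRD mulrC ler_pM ?cmod_ge0 ?le_expRx//.
  by rewrite (le_trans (cmod_expC_le _))// cmodM mulrC.
have [D hD] := abs_summable_cvg sD; exists D.
have [K hK] := ab (cmod z + 3).
have K0 : 0 <= K by have := hK 0%N; rewrite big_ord0.
move=> e e0; exists (Num.min 1 (e / (6 * K + 1))).
  by rewrite lt_min ltr01 divr_gt0// ltr_wpDl// mulr_ge0.
move=> h; rewrite lt_min => /andP[h1].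
rewrite ltr_pdivlMr; last by rewrite ltr_wpDl// mulr_ge0.
move=> h2; have h0 := cmod_ge0 h.
suff : cmod (S (z + h) - S z - D * h) <= 6 * cmod h ^+ 2 * K.
  move=> /le_trans; apply; rewrite expr2; nra.
have L : clim (csum (fun i => a i * expC (b i * (z + h))
      + (-1) * (a i * expC (b i * z)) + (- h) * (a i * b i * expC (b i * z))))
    (S (z + h) - S z - D * h).
  apply: (@clim_ext _ (fun m => csum (fun i => a i * expC (b i * (z + h))) m
     + (-1) * csum (fun i => a i * expC (b i * z)) m +
     (- h) * csum (fun i => a i * b i * expC (b i * z)) m)).
    by move=> m; rewrite !csumD !csumZ.
  have -> : S (z + h) - S z - D * h = S (z + h) + (-1) * S z + (- h) * D by ring.
  by apply: climD; [apply: climD => //|]; apply: climM => //; exact: clim_cst.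
apply: abs_summable_cmod_lim L => m.
apply: le_trans (_ : 6 * cmod h ^+ 2 *
   (\sum_(i < m) cmod (a i) * expR ((cmod z + 3) * cmod (b i))) <= _); last first.
  by rewrite ler_wpM2l// mulr_ge0// sqr_ge0.
rewrite mulr_sumr; apply: ler_sum => i _.
have -> : a i * expC (b i * (z + h)) + -1 * (a i * expC (b i * z)) +
     - h * (a i * b i * expC (b i * z)) =
   a i * expC (b i * z) * (expC (b i * h) - 1 - b i * h).
  by rewrite mulrDr expCD; ring.
rewrite [leRHS]mulrCA 2!cmodM -[leLHS]mulrA.
apply: ler_wpM2l; first exact: cmod_ge0.
have -> : (cmod z + 3) * cmod (b i) = cmod (b i * z) + (cmod (b i) + cmod (b i) + cmod (b i)).
  by rewrite cmodM; ring.
rewrite expRD mulrCA; apply: ler_pM; rewrite ?cmod_ge0 ?cmod_expC_le//.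
apply: le_trans (expC_taylor _) _; have B0 := cmod_ge0 (b i).
have -> : 6 * cmod (b i * h) ^+ 2 * expR (cmod (b i * h)) =
  6 * cmod h ^+ 2 * (cmod (b i) * cmod (b i) * expR (cmod (b i * h))) by rewrite cmodM; ring.
apply: ler_wpM2l; first by rewrite mulr_ge0 ?sqr_ge0.
rewrite !expRD; apply: ler_pM => //; rewrite ?mulr_ge0 ?expR_ge0//.
  by apply: ler_pM => //; exact: le_expRx.
by rewrite ler_expR cmodM ler_piMr// ltW.
Qed.

End ExpSeries.

(** * Integrals of continuous real functions over the unit interval *)

Section RealIntegral.
Variable R : realType.
Implicit Types (g G : R -> R) (x : R).
Local Notation mu := (@lebesgue_measure R).

Definition rint g : R := (\int[mu]_(x in `[0, 1]) g x)%R.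

(** A primitive on an open neighbourhood of [0, 1], so that no one-sided
    derivatives occur at the endpoints and so that the primitive of
    x |-> g((x + b) / 2) is obtained by rescaling. *)
Definition primitive g G := forall x, -1 < x < 2 -> is_derive x 1 G (g x).

Lemma primitive_exists g : continuous g -> exists G, primitive g G.
Proof.
move=> cg; exists (fun x => \int[mu]_(t in `[-1, x]) g t)%R => x /andP[x1 x2].
have ig : mu.-integrable `[-1, 2] (EFin \o g).
  apply: continuous_compact_integrable; first exact: segment_compact.
  exact: continuous_subspaceT.
have [h1 h2] := continuous_FTC1_closed x2 ig x1 (cg x).
by split; [exact: h1|rewrite -derive1E; exact: h2].
Qed.

Lemma primitive_cont g G x : primitive g G -> 0 <= x <= 1 -> {for x, continuous G}.
Proof.
move=> gG /andP[x0 x1]; apply: differentiable_continuous.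
apply/derivable1_diffP; have [] : is_derive x 1 G (g x); last by [].
by apply: gG; lra.
Qed.

Lemma primitive_within g G : primitive g G -> {within `[0, 1], continuous G}.
Proof.
move=> gG; apply: continuous_in_subspaceT => x; rewrite inE /= in_itv /=.
exact: primitive_cont gG.
Qed.

(** The algebraic properties of the integral that follow are all read off from
    this formula, by operating on primitives. *)
Lemma rint_primitive g G : continuous g -> primitive g G -> rint g = G 1 - G 0.
Proof.
move=> cg gG; rewrite /rint /Rintegral (@continuous_FTC2 _ g G)//.
- exact: continuous_subspaceT.
- split.
  + move=> x; rewrite in_itv /= => /andP[x0 x1].
    by have [|] := gG x _ => //; lra.
  + by apply: cvg_at_right_filter; apply: primitive_cont gG _; rewrite lexx ler01.
  + by apply: cvg_at_left_filter; apply: primitive_cont gG _; rewrite lexx ler01.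
- move=> x; rewrite in_itv /= => /andP[x0 x1].
  have [|_ <-] := gG x _; first lra.
  by rewrite derive1E.
Qed.

(** Stands in for monotonicity of the integral: bounds and signs of the integrand
    pass to the integral through its value at the mean point. *)
Lemma rint_mean g : continuous g -> exists2 c, 0 <= c <= 1 & rint g = g c.
Proof.
move=> cg; have [G gG] := primitive_exists cg.
have [x|//|c] := @MVT R G g 0 1 ltr01; last first.
  rewrite in_itv /= => /andP[c0 c1] E; exists c; first by rewrite !ltW.
  by rewrite (rint_primitive cg gG) E subr0 mulr1.
- exact: primitive_within gG.
- rewrite in_itv /= => /andP[x0 x1]; apply: gG; lra.
Qed.

Lemma rintD g h : continuous g -> continuous h ->
  rint (fun x => g x + h x) = rint g + rint h.
Proof.
move=> cg ch; have [G gG] := primitive_exists cg.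
have [H hH] := primitive_exists ch.
rewrite (rint_primitive cg gG) (rint_primitive ch hH).
have := @rint_primitive (fun x => g x + h x) (G + H).
move=> ->; first by rewrite -[(G + H) 1]/(G 1 + H 1) -[(G + H) 0]/(G 0 + H 0); ring.
  by move=> x; apply: continuousD; [exact: cg|exact: ch].
by move=> x x1; apply: is_deriveD; [exact: gG|exact: hH].
Qed.

Lemma rintZ c g : continuous g -> rint (fun x => c * g x) = c * rint g.
Proof.
move=> cg; have [G gG] := primitive_exists cg.
rewrite (rint_primitive cg gG).
have := @rint_primitive (fun x => c * g x) (fun x => c * G x).
move=> ->; first by rewrite mulrBr.
  by move=> x; apply: continuousM; [exact: cst_continuous|exact: cg].
by move=> x x1; apply: (@is_deriveZ R R R); exact: gG.
Qed.

Lemma primitive_half g G (b : R) : 0 <= b <= 1 -> primitive g G ->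
  primitive (fun x => g (2^-1 * (x + b))) (fun x => 2 * G (2^-1 * (x + b))).
Proof.
move=> b01 gG x x1.
have gd : is_derive (2^-1 * (x + b)) 1 G (g (2^-1 * (x + b))) by apply: gG; lra.
have ad : is_derive x 1 (fun x => 2^-1 * (x + b)) (2^-1 : R).
  have := @is_deriveZ R R R (fun x => x + b) 2^-1 x 1 1.
  rewrite /GRing.scale /= mulr1; apply.
  have -> : (fun x : R => x + b) = id + cst b by [].
  by rewrite -[X in is_derive _ _ _ X]addr0; apply: is_deriveD.
have := @is_deriveZ R R R _ 2 x 1 _ (@is_derive1_comp R G (fun x => 2^-1 * (x + b)) x _ _ gd ad).
by rewrite /GRing.scale /= mulrCA divff// mulr1.
Qed.

Lemma rint_half g : continuous g ->
  rint g = 2^-1 * (rint (fun x => g (2^-1 * (x + 0))) + rint (fun x => g (2^-1 * (x + 1)))).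
Proof.
move=> cg; have [G gG] := primitive_exists cg.
have ch b : continuous (fun x => g (2^-1 * (x + b))).
  move=> x; apply: continuous_comp; last exact: cg.
  apply: continuousM; first exact: cst_continuous.
  by apply: continuousD => //; exact: cst_continuous.
rewrite (rint_primitive cg gG).
rewrite (rint_primitive (ch 0) (primitive_half _ gG)); last lra.
rewrite (rint_primitive (ch 1) (primitive_half _ gG)); last lra.
have -> : 2^-1 * (1 + 1) = 1 :> R by lra.
have -> : 2^-1 * (0 + 0) = 0 :> R by lra.
by rewrite addr0 add0r; lra.
Qed.

End RealIntegral.

(** * Integrals of continuous complex-valued functions over the unit interval *)

Section ComplexIntegral.
Variable R : realType.
Local Notation C := R[i].
Implicit Types (g h : R -> C) (x : R) (f : C -> C).

Definition ccont g := continuous (fun x => complex.Re (g x)) /\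
  continuous (fun x => complex.Im (g x)).

Definition cint g : C :=
  rint (fun x => complex.Re (g x)) +i* rint (fun x => complex.Im (g x)).

Lemma cint_ext g h : g =1 h -> cint g = cint h.
Proof. by move=> /funext ->. Qed.

Lemma ccontP g : (forall x (e : R), 0 < e -> exists2 r : R, 0 < r &
    forall t, `|t| < r -> cmod (g (x + t) - g x) < e) -> ccont g.
Proof.
move=> H; split=> x; apply/cvgrPdist_lt => e e0; have [r r0 gr] := H x e e0.
  apply/nbhs_ballP; exists r => //= t; rewrite /ball /= => xt.
  have := gr (t - x); rewrite [x + _]addrC subrK distrC => /(_ xt); apply: le_lt_trans.
  by rewrite distrC; apply: le_trans (cmod_Re _); case: (g t) (g x) => ? ? [].
apply/nbhs_ballP; exists r => //= t; rewrite /ball /= => xt.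
have := gr (t - x); rewrite [x + _]addrC subrK distrC => /(_ xt); apply: le_lt_trans.
by rewrite distrC; apply: le_trans (cmod_Im _); case: (g t) (g x) => ? ? [].
Qed.

Lemma ccont_entire f (p d : C) : entire f -> ccont (fun x => f (p + x%:C * d)).
Proof.
move=> fe; apply: ccontP => x e e0.
have [D /has_cderiv_cont /(_ e e0)[r r0 fr]] := fe (p + x%:C * d).
have d1 : 0 < cmod d + 1 by rewrite ltr_wpDl ?cmod_ge0.
exists (r / (cmod d + 1)); first by rewrite divr_gt0.
move=> t; rewrite ltr_pdivlMr// => tr.
have -> : p + (x + t)%:C * d = p + x%:C * d + t%:C * d by rewrite rmorphD /=; ring.
apply: fr; rewrite cmodM cmodR; apply: le_lt_trans tr.
by rewrite mulrDr mulr1 lerDl.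
Qed.

Lemma ccont_real f : entire f -> ccont (fun x => f x%:C).
Proof.
move=> fe; have := ccont_entire 0 1 fe.
by under [fun x : R => f (_ + _)]funext do rewrite mulr1 add0r.
Qed.

Lemma ccont_cst (c : C) : ccont (fun=> c).
Proof. by split=> x; exact: cvg_cst. Qed.

Lemma ccontD g h : ccont g -> ccont h -> ccont (fun x => g x + h x).
Proof.
move=> [g1 g2] [h1 h2]; split=> x.
  have -> : (fun x => complex.Re (g x + h x)) =
    (fun x => complex.Re (g x) + complex.Re (h x)).
    by apply/funext => y; case: (g y) (h y) => ? ? [].
  by apply: continuousD; [exact: g1|exact: h1].
have -> : (fun x => complex.Im (g x + h x)) =
  (fun x => complex.Im (g x) + complex.Im (h x)).
  by apply/funext => y; case: (g y) (h y) => ? ? [].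
by apply: continuousD; [exact: g2|exact: h2].
Qed.

Lemma ccontM g h : ccont g -> ccont h -> ccont (fun x => g x * h x).
Proof.
move=> [g1 g2] [h1 h2]; split=> x.
  have -> : (fun x => complex.Re (g x * h x)) =
    (fun x => complex.Re (g x) * complex.Re (h x) - complex.Im (g x) * complex.Im (h x)).
    by apply/funext => y; case: (g y) (h y) => ? ? [].
  exact: (cvgB (cvgM (g1 x) (h1 x)) (cvgM (g2 x) (h2 x))).
have -> : (fun x => complex.Im (g x * h x)) =
  (fun x => complex.Re (g x) * complex.Im (h x) + complex.Im (g x) * complex.Re (h x)).
  by apply/funext => y; case: (g y) (h y) => ? ? [].
exact: (cvgD (cvgM (g1 x) (h2 x)) (cvgM (g2 x) (h1 x))).
Qed.

Lemma ccont_conj g : ccont g -> ccont (fun x => (g x)^*).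
Proof.
move=> [g1 g2]; split=> x.
  have -> : (fun x => complex.Re (g x)^*) = (fun x => complex.Re (g x)).
    by apply/funext => y; case: (g y).
  exact: g1.
have -> : (fun x => complex.Im (g x)^*) = (fun x => - complex.Im (g x)).
  by apply/funext => y; case: (g y).
by apply: continuousN; exact: g2.
Qed.

Lemma cintD g h : ccont g -> ccont h ->
  cint (fun x => g x + h x) = cint g + cint h.
Proof.
move=> [g1 g2] [h1 h2]; rewrite /cint; simpc; rewrite -!rintD//.
by congr (_ +i* _); congr rint; apply/funext => y; case: (g y) (h y) => ? ? [].
Qed.

Lemma cintZ (c : C) g : ccont g -> cint (fun x => c * g x) = c * cint g.
Proof.
case: c => a b [g1 g2]; rewrite /cint; simpc.
have cM (u : R) (k : R -> R) : continuous k -> continuous (fun x => u * k x).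
  by move=> ck y; apply: continuousM; [exact: cst_continuous|exact: ck].
rewrite -mulNr -!rintZ// -!rintD; try exact: cM.
by congr (_ +i* _); congr rint; apply/funext => y; case: (g y) => ? ?;
  rewrite /= ?mulNr.
Qed.

Lemma cint_cst (c : C) : cint (fun=> c) = c.
Proof.
case: c => a b; rewrite /cint /=.
have rc (u : R) : rint (fun=> u) = u.
  by have [|c _ ->] := @rint_mean R (fun=> u); first exact: cst_continuous.
by rewrite !rc.
Qed.

(** The factor 2 comes from bounding real and imaginary parts separately; the
    arguments below are insensitive to constants. *)
Lemma cint_bound g (M : R) : ccont g -> (forall x, 0 <= x <= 1 -> cmod (g x) <= M) ->
  cmod (cint g) <= 2 * M.
Proof.
move=> [g1 g2] gM; apply: le_trans (cmod_le_ReIm _) _; rewrite /cint /=.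
have [a /gM aM ->] := rint_mean g1; have [b /gM bM ->] := rint_mean g2.
have := cmod_Re (g a); have := cmod_Im (g b); lra.
Qed.

Lemma cint_conj g : ccont g -> cint (fun x => (g x)^*) = (cint g)^*.
Proof.
move=> [g1 g2]; rewrite /cint; simpc; rewrite -[- _]mulN1r -rintZ//.
by congr (_ +i* _); congr rint; apply/funext => y; case: (g y) => ? ? /=;
  rewrite ?mulN1r.
Qed.

Lemma cint_half g : ccont g -> cint g =
  2^-1 * (cint (fun x => g (2^-1 * (x + 0))) + cint (fun x => g (2^-1 * (x + 1)))).
Proof.
move=> [g1 g2]; rewrite /cint (rint_half g1) (rint_half g2).
have -> : (2^-1 : C) = (2^-1 : R)%:C by rewrite fmorphV rmorph_nat.
by simpc.
Qed.

(** The real counterpart of [has_cderiv_lib], needed to recognize the real and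
    imaginary parts of a complex primitive restricted to the real line. *)
Lemma is_derive_littleo (phi : R -> R) x (d : R) : (forall e : R, 0 < e ->
    exists2 r : R, 0 < r & forall h : R, `|h| < r ->
    `|phi (x + h) - phi x - d * h| <= e * `|h|) -> is_derive x 1 phi d.
Proof.
move=> fd; have key : (fun h : R => h^-1 *: (phi (h *: (1 : R) + x) - phi x))
    @ (0 : R)^' --> d.
  apply/cvgrPdist_le => e e0; have [r r0 fr] := fd _ e0.
  exists r => //= h /=; rewrite sub0r normrN => hr h0.
  have -> : d - h^-1 *: (phi (h *: (1 : R) + x) - phi x) =
      - (h^-1 * (phi (x + h) - phi x - d * h)).
    rewrite /GRing.scale /= mulr1 (addrC h) [in RHS]mulrBr [_ * (d * h)]mulrCA.
    by rewrite mulVf ?mulr1 ?opprB.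
  rewrite normrN normrM normfV mulrC ler_pdivrMr ?normr_gt0//; exact: fr.
split; first by apply/cvg_ex; exists d.
by rewrite /derive; apply: cvg_lim => //.
Qed.

Lemma cint_derive (F f : C -> C) : (forall z, has_cderiv F z (f z)) -> entire f ->
  cint (fun x => f x%:C) = F 1 - F 0.
Proof.
move=> Ff fe; have [f1 f2] := ccont_real fe.
have key (pr : C -> R) : {morph pr : z w / z - w} ->
   (forall z (x : R), pr (z * x%:C) = pr z * x) -> (forall z, `|pr z| <= cmod z) ->
   primitive (fun x => pr (f x%:C)) (fun x => pr (F x%:C)).
  move=> prB prZ prn x _; apply: is_derive_littleo => e e0.
  have [r r0 fr] := Ff x%:C e e0; exists r => // h hr.
  rewrite -prZ -!prB rmorphD /= (le_trans (prn _))// -(cmodR h).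
  by apply: fr; rewrite cmodR.
have p1 := @key (@complex.Re R) _ _ (@cmod_Re R).
have p2 := @key (@complex.Im R) _ _ (@cmod_Im R).
rewrite /cint (rint_primitive f1 (p1 _ _)); first last.
- by case=> a b y; simpc.
- by case=> a b [].
rewrite (rint_primitive f2 (p2 _ _)); first last.
- by case=> a b y; simpc.
- by case=> a b [].
by rewrite -[1%:C]/(1 : C) -[0%:C]/(0 : C); case: (F 1) (F 0) => ? ? [].
Qed.

End ComplexIntegral.

(** * Goursat's lemma for parallelograms *)

Section Goursat.
Variable R : realType.
Local Notation C := R[i].
Implicit Types (f : C -> C) (p d e q : C).

Definition segment_integral f p d := d * cint (fun x : R => f (p + x%:C * d)).

(** The boundary is traversed through p, p + d, p + d + e, p + e in this order. *)
Definition boundary_integral f p d e :=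
  segment_integral f p d + segment_integral f (p + d) e - segment_integral f (p + e) d - segment_integral f p e.

Lemma segment_integral_half f p d : entire f ->
  segment_integral f p (2 * d) = segment_integral f p d + segment_integral f (p + d) d.
Proof.
move=> fe; rewrite /segment_integral (cint_half (ccont_entire p (2 * d) fe)).
have E (a b : C) : 2 * d * (2^-1 * (a + b)) = d * a + d * b by field.
rewrite E; congr (_ + _).
  congr (_ * _); apply: cint_ext => x; congr f; congr (_ + _).
  rewrite addr0 rmorphM /= fmorphV rmorph_nat.
  by rewrite mulrCA !mulrA divff ?pnatr_eq0// mul1r.
congr (_ * _); apply: cint_ext => x; congr f; rewrite -addrA; congr (_ + _).
rewrite rmorphM rmorphD /= fmorphV rmorph_nat.
by rewrite mulrCA !mulrA divff ?pnatr_eq0// mul1r mulrDl addrC mul1r.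
Qed.

(** Integrals over the inner sides cancel, so that the boundary integral is
    additive under the subdivision into four similar parallelograms. *)
Lemma boundary_integral_quarter f p d e : entire f -> boundary_integral f p (2 * d) (2 * e) =
  boundary_integral f p d e + boundary_integral f (p + d) d e + boundary_integral f (p + e) d e +
  boundary_integral f (p + d + e) d e.
Proof.
move=> fe; rewrite /boundary_integral !segment_integral_half//.
have -> : p + 2 * d = p + d + d by ring.
have -> : p + 2 * e = p + e + e by ring.
have -> : p + e + d = p + d + e by ring.
have -> : p + e + e + d = p + d + e + e by ring.
have -> : p + d + d + e = p + d + e + d by ring.
ring.
Qed.

Lemma has_cderiv_quadratic (A B z : C) :
  has_cderiv (fun w => A * w + B / 2 * (w * w)) z (A + B * z).
Proof.
move=> a a0; have b0 : 0 < cmod (B / 2) + 1 by rewrite ltr_wpDl ?cmod_ge0.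
exists (a / (cmod (B / 2) + 1)); first by rewrite divr_gt0.
move=> h; rewrite ltr_pdivlMr// => ha.
have -> : A * (z + h) + B / 2 * ((z + h) * (z + h)) - (A * z + B / 2 * (z * z))
  - (A + B * z) * h = B / 2 * h * h by field.
rewrite 2!cmodM ler_wpM2r ?cmod_ge0//; have := cmod_ge0 h; lra.
Qed.

Lemma entire_affine (A B : C) : entire (fun z => A + B * z).
Proof.
move=> z; exists B => a a0; exists 1 => // h _.
have -> : A + B * (z + h) - (A + B * z) - B * h = 0 by ring.
by rewrite cmod0 mulr_ge0 ?cmod_ge0// ltW.
Qed.

(** An affine function has a primitive, so only the affine approximation error
    contributes to the boundary integral of a differentiable function. *)
Lemma boundary_integral_affine (A B : C) p d e : boundary_integral (fun z => A + B * z) p d e = 0.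
Proof.
have E (a b : C) : segment_integral (fun z => A + B * z) a b =
    b * (A + B * a + B * b / 2).
  rewrite /segment_integral; congr (_ * _).
  rewrite (cint_ext (h := fun x => (A + B * a) + (B * b) * x%:C)); last first.
    by move=> x; ring.
  rewrite (cint_derive (F := fun w => (A + B * a) * w + (B * b) / 2 * (w * w))
    (f := fun w => (A + B * a) + (B * b) * w)).
  - by rewrite !mulr0 !mulr1 addr0 subr0.
  - by move=> z; exact: has_cderiv_quadratic.
  - exact: entire_affine.
rewrite /boundary_integral !E; ring.
Qed.

Lemma boundary_integral_bound f p d e (M : R) : entire f ->
  (forall x y : R, 0 <= x <= 1 -> 0 <= y <= 1 ->
    cmod (f (p + x%:C * d + y%:C * e)) <= M) ->
  cmod (boundary_integral f p d e) <= 4 * (cmod d + cmod e) * M.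
Proof.
move=> fe fM.
have seg (a b : C) : (forall x : R, 0 <= x <= 1 -> cmod (f (a + x%:C * b)) <= M) ->
    cmod (segment_integral f a b) <= cmod b * (2 * M).
  move=> h; rewrite /segment_integral cmodM ler_wpM2l ?cmod_ge0// cint_bound//.
  exact: ccont_entire.
have z01 : 0 <= (0 : R) <= 1 by rewrite lexx ler01.
have o01 : 0 <= (1 : R) <= 1 by rewrite lexx ler01.
have s1 : cmod (segment_integral f p d) <= cmod d * (2 * M).
  by apply: seg => x x01; have := fM x 0 x01 z01; rewrite mul0r addr0.
have s2 : cmod (segment_integral f (p + d) e) <= cmod e * (2 * M).
  by apply: seg => x x01; have := fM 1 x o01 x01; rewrite mul1r.
have s3 : cmod (segment_integral f (p + e) d) <= cmod d * (2 * M).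
  by apply: seg => x x01; have := fM x 1 x01 o01; rewrite mul1r addrAC.
have s4 : cmod (segment_integral f p e) <= cmod e * (2 * M).
  by apply: seg => x x01; have := fM 0 x z01 x01; rewrite mul0r addr0.
rewrite /boundary_integral.
have := cmodB (segment_integral f p d + segment_integral f (p + d) e - segment_integral f (p + e) d) (segment_integral f p e).
have := cmodB (segment_integral f p d + segment_integral f (p + d) e) (segment_integral f (p + e) d).
have := cmodD (segment_integral f p d) (segment_integral f (p + d) e).
lra.
Qed.

Lemma boundary_integralD f g p d e : entire f -> entire g ->
  boundary_integral (fun z => f z + g z) p d e = boundary_integral f p d e + boundary_integral g p d e.
Proof.
move=> fe ge; have E a b : segment_integral (fun z => f z + g z) a b =
    segment_integral f a b + segment_integral g a b.
  rewrite /segment_integral -mulrDr; congr (_ * _).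
  exact: (cintD (ccont_entire a b fe) (ccont_entire a b ge)).
rewrite /boundary_integral !E; ring.
Qed.

(** Near a point q where f is differentiable, the boundary integral is small
    compared with the squared size of the parallelogram. *)
Lemma boundary_integral_local f q B p d e (eps r : R) : entire f -> 0 <= eps ->
  (forall h, cmod h < r -> cmod (f (q + h) - f q - B * h) <= eps * cmod h) ->
  cmod (q - p) <= cmod d + cmod e -> 2 * (cmod d + cmod e) < r ->
  cmod (boundary_integral f p d e) <= 8 * eps * (cmod d + cmod e) ^+ 2.
Proof.
move=> fe eps0 fr qp rL; set L := cmod d + cmod e.
(* A - B z is minus the affine approximation of f at q. *)
pose A := - f q + B * q.
have ae := entire_affine A (- B).
have -> : boundary_integral f p d e = boundary_integral (fun z => f z + (A + (- B) * z)) p d e.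
  by rewrite boundary_integralD// boundary_integral_affine addr0.
have -> : 8 * eps * L ^+ 2 = 4 * (cmod d + cmod e) * (eps * (2 * L)) by rewrite /L;
  ring.
apply: boundary_integral_bound; first exact: entireD.
move=> x y /andP[x0 x1] /andP[y0 y1]; set z := p + _ + _.
have zq : cmod (z - q) <= 2 * L.
  have -> : z - q = (p - q) + (x%:C * d + y%:C * e) by rewrite /z; ring.
  have := cmodD (p - q) (x%:C * d + y%:C * e); have := cmodD (x%:C * d) (y%:C * e).
  rewrite !cmodM !cmodR !ger0_norm// cmodBC.
  have := ler_piMl (cmod_ge0 d) x1; have := ler_piMl (cmod_ge0 e) y1.
  rewrite /L in qp *; lra.
have /fr : cmod (z - q) < r by exact: le_lt_trans rL.
have -> : f (q + (z - q)) - f q - B * (z - q) = f z + (A + - B * z).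
  by rewrite (addrC q) subrK /A; ring.
move=> /le_trans; apply; exact: ler_wpM2l.
Qed.

Lemma exists_half_pow (L r : R) : 0 < r -> exists k, L * 2^-1 ^+ k < r.
Proof.
move=> r0; have [L0|L0] := leP L 0.
  by exists 0%N; rewrite expr0 mulr1; exact: le_lt_trans r0.
exists (Num.bound (L / r)); set k := Num.bound _.
have Lk : L / r < k%:R by apply: archi_boundP; rewrite divr_ge0 ?ltW.
have k2 : k%:R < 2 ^+ k :> R by rewrite -natrX ltr_nat ltn_expl.
rewrite exprVn ltr_pdivrMr ?exprn_gt0//.
by rewrite mulrC -ltr_pdivrMr// (lt_trans Lk).
Qed.

(** Goursat's argument, which assumes differentiability but not continuity of
    the derivative. If the integral were nonzero, repeated subdivision would give
    parallelograms shrinking to a point q whose k-th integral is at least 4^-k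
    times the first one; differentiability at q contradicts this. *)
Lemma boundary_integral_eq0 f p d e : entire f -> boundary_integral f p d e = 0.
Proof.
move=> fe; apply/eqP; apply: contraT; rewrite -cmod_gt0; set delta := cmod _ => delta0.
set L := cmod d + cmod e; have L0 : 0 <= L by rewrite addr_ge0 ?cmod_ge0.
pose D k : C := 2^-1 ^+ k * d; pose E k : C := 2^-1 ^+ k * e.
pose J p k := boundary_integral f p (D k) (E k).
have hc k : cmod (2^-1 ^+ k : C) = 2^-1 ^+ k.
  by rewrite cmodX cmodV cmod_nat.
have DE k : cmod (D k) + cmod (E k) = L * 2^-1 ^+ k.
  by rewrite /D /E !cmodM hc /L; ring.
(* One of the four quarters carries at least a quarter of the integral. *)
have step (kp : nat * C) : exists p', cmod (p' - kp.2) <= L * 2^-1 ^+ kp.1.+1 /\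
    cmod (J kp.2 kp.1) <= 4 * cmod (J p' kp.1.+1).
  case: kp => k b /=.
  have D2 : D k = 2 * D k.+1 by rewrite /D exprS; field.
  have E2 : E k = 2 * E k.+1 by rewrite /E exprS; field.
  have [dL eL] : cmod (D k.+1) <= L * 2^-1 ^+ k.+1 /\ cmod (E k.+1) <= L * 2^-1 ^+ k.+1.
    by have := DE k.+1; have := cmod_ge0 (D k.+1); have := cmod_ge0 (E k.+1); lra.
  have JE : J b k = J b k.+1 + J (b + D k.+1) k.+1 + J (b + E k.+1) k.+1 +
      J (b + D k.+1 + E k.+1) k.+1.
    by rewrite /J D2 E2 boundary_integral_quarter.
  have := cmodD (J b k.+1 + J (b + D k.+1) k.+1 + J (b + E k.+1) k.+1)
    (J (b + D k.+1 + E k.+1) k.+1).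
  have := cmodD (J b k.+1 + J (b + D k.+1) k.+1) (J (b + E k.+1) k.+1).
  have := cmodD (J b k.+1) (J (b + D k.+1) k.+1); rewrite -JE => h1 h2 h3.
  have [j1|j1] := leP (cmod (J b k)) (4 * cmod (J b k.+1)).
    by exists b; rewrite subrr cmod0 mulr_ge0// exprn_ge0.
  have [j2|j2] := leP (cmod (J b k)) (4 * cmod (J (b + D k.+1) k.+1)).
    by exists (b + D k.+1); rewrite addrC addKr.
  have [j3|j3] := leP (cmod (J b k)) (4 * cmod (J (b + E k.+1) k.+1)).
    by exists (b + E k.+1); rewrite addrC addKr.
  exists (b + D k.+1 + E k.+1); split; last lra.
  have -> : b + D k.+1 + E k.+1 - b = D k.+1 + E k.+1 by ring.
  by rewrite (le_trans (cmodD _ _))// DE.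
(* P k is the base vertex of the k-th parallelogram; q is the limit of the P k. *)
have [nxt hnxt] := choice step.
pose P := fix P k := if k is k'.+1 then nxt (k', P k') else p.
have P1 k : cmod (P k.+1 - P k) <= L * 2^-1 ^+ k.+1 := (hnxt (k, P k)).1.
have P2 k : cmod (J (P k) k) <= 4 * cmod (J (P k.+1) k.+1) := (hnxt (k, P k)).2.
have J0 k : delta <= 4 ^+ k * cmod (J (P k) k).
  elim: k => [|k IH]; first by rewrite /J /D /E !expr0 !mul1r.
  by apply: le_trans IH _; rewrite exprSr -mulrA ler_wpM2l ?exprn_ge0.
pose a k := P k.+1 - P k.
have Pa k : csum a k = P k - p.
  elim: k => [|k IH]; first by rewrite /csum big_ord0 subrr.
  have -> : csum a k.+1 = csum a k + a k by rewrite /csum big_ord_recr.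
  by rewrite IH /a addrC addrA subrK.
have sa : abs_summable a.
  exists L => k; suff: \sum_(i < k) cmod (a i) <= L * (1 - 2^-1 ^+ k).
    move=> /le_trans; apply; rewrite ler_piMr// lerBlDr lerDl exprn_ge0//.
  elim: k => [|k IH]; first by rewrite big_ord0 expr0 subrr mulr0.
  rewrite big_ord_recr /=; apply: le_trans (lerD IH (P1 k)) _.
  rewrite exprS; lra.
have [s hs] := abs_summable_cvg sa.
pose q := p + s.
have Pq k : cmod (q - P k) <= L * 2^-1 ^+ k.
  have hk m : cmod (P (k + m)%N - P k) <= L * (2^-1 ^+ k - 2^-1 ^+ (k + m)).
    elim: m => [|m IH]; first by rewrite addn0 !subrr cmod0 mulr0.
    have -> : P (k + m.+1)%N - P k = (P (k + m).+1 - P (k + m)%N) + (P (k + m)%N - P k).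
      by rewrite addnS addrA subrK.
    rewrite (le_trans (cmodD _ _))// (le_trans (lerD (P1 _) IH))//.
    rewrite addnS exprS; lra.
  have hl : clim (fun m => P (k + m)%N - P k) (q - P k).
    apply: (@clim_ext _ (fun m => csum a (k + m)%N + (p - P k))).
      by move=> m; rewrite Pa; ring.
    have -> : q - P k = s + (p - P k) by rewrite /q; ring.
    apply: climD; last exact: clim_cst.
    by apply: (clim_sub _ hs) => m; rewrite leq_addl.
  apply: clim_cmod_le hl _ => m; apply: le_trans (hk m) _.
  by rewrite ler_wpM2l// lerBlDr lerDl exprn_ge0.
have [B fB] := fe q.
pose eps := delta / (8 * L ^+ 2 + 1).
have den : 0 < 8 * L ^+ 2 + 1 by rewrite ltr_wpDl ?mulr_ge0 ?sqr_ge0.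
have eps0 : 0 < eps by rewrite divr_gt0.
have [r r0 fr] := fB eps eps0.
have [k kr] := exists_half_pow (2 * L) r0.
have qPk : cmod (q - P k) <= cmod (D k) + cmod (E k) by rewrite DE.
have Lk : 2 * (cmod (D k) + cmod (E k)) < r by rewrite DE mulrA.
have := boundary_integral_local fe (ltW eps0) fr qPk Lk.
rewrite -/(J (P k) k) DE => hJ.
have : delta <= 4 ^+ k * (8 * eps * (L * 2^-1 ^+ k) ^+ 2).
  by apply: le_trans (J0 k) _; rewrite ler_wpM2l ?exprn_ge0.
have -> : 4 ^+ k * (8 * eps * (L * 2^-1 ^+ k) ^+ 2) = eps * (8 * L ^+ 2).
  have : (4 : R) ^+ k * (2^-1 ^+ k * 2^-1 ^+ k) = 1.
    by rewrite -!exprMn (_ : 4 * (2^-1 * 2^-1) = 1) ?expr1n//; field.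
  move: (2^-1 ^+ k) ((4 : R) ^+ k) => X Y XY.
  by rewrite -[RHS]mul1r -XY; ring.
rewrite leNgt /eps mulrAC ltr_pdivrMr// mulrDr mulr1.
by rewrite ltrDl delta0.
Qed.

(** In the parallelogram with sides 1 and w, the two sides parallel to w carry
    the same integral by periodicity, so the integrals over the other two agree. *)
Lemma periodic_mean f w : entire f -> (forall z, f (z + 1) = f z) ->
  cint (fun x : R => f (x%:C + w)) = cint (fun x : R => f x%:C).
Proof.
move=> fe fp; have := boundary_integral_eq0 0 1 w fe; rewrite /boundary_integral /segment_integral.
have -> : cint (fun x : R => f (0 + 1 + x%:C * w)) = cint (fun x :
  R => f (0 + x%:C * w)).
  by apply: cint_ext => x; rewrite add0r [1 + _]addrC fp add0r.
rewrite !mul1r addrAC addrK => /eqP; rewrite subr_eq0 => /eqP h.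
rewrite (cint_ext (h := fun x : R => f (0 + w + x%:C * 1))); last first.
  by move=> x; rewrite add0r mulr1 addrC.
by rewrite -h; apply: cint_ext => x; rewrite add0r mulr1.
Qed.

End Goursat.

(** * Fourier coefficients and Bessel's inequality *)

Section Fourier.
Variable R : realType.
Local Notation C := R[i].
Implicit Types (f : C -> C) (g k : R -> C) (m n : int) (x : R) (c : C).

(** The characters of the circle R / Z. *)
Definition echar m x : C := e2pi (m%:~R * x%:C).

Lemma echarD m n x : echar (m + n) x = echar m x * echar n x.
Proof. by rewrite /echar rmorphD /= mulrDl e2piD. Qed.

Lemma echar0 x : echar 0 x = 1.
Proof. by rewrite /echar mul0r e2pi0. Qed.

Lemma echar_conj m x : (echar m x)^* = echar (- m) x.
Proof.
rewrite /echar rmorphN /= mulNr -(rmorph_int (real_complex R)) -rmorphM /=.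
rewrite /e2pi /piC /iC /expC; simpc.
by rewrite /= sinN cosN expR0; simpc.
Qed.

Lemma ccont_echar m : ccont (echar m).
Proof. exact: (ccont_real (@entire_e2pi R m)). Qed.

Lemma has_cderiv_e2pi m (z : C) : has_cderiv (fun w => e2pi (m%:~R * w)) z
   (2 * piC * iC * m%:~R * e2pi (m%:~R * z)).
Proof.
have E : (fun w : C => e2pi (m%:~R * w)) = (fun w => expC (2 * piC * iC * m%:~R * w)).
  by apply/funext => w; rewrite /e2pi mulrA.
rewrite E /e2pi [X in expC X](mulrA _ m%:~R z). exact: has_cderiv_expC.
Qed.

Lemma two_pi_i_neq0 : 2 * piC * iC != 0 :> C.
Proof.
rewrite !mulf_neq0 ?pnatr_eq0//.
  by rewrite /piC eq_complex /= eqxx andbT gt_eqF// pi_gt0.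
by rewrite /iC eq_complex /= eqxx oner_eq0.
Qed.

Lemma cint_echar m : m != 0 -> cint (echar m) = 0.
Proof.
move=> m0; pose a : C := 2 * piC * iC * m%:~R.
have a0 : a != 0 by rewrite mulf_neq0 ?two_pi_i_neq0// intr_eq0.
rewrite (cint_derive (F := fun w => a^-1 * e2pi (m%:~R * w))
   (f := fun w => e2pi (m%:~R * w))).
- by rewrite mulr1 mulr0 e2pi0 e2pi_int subrr.
- move=> z; have := has_cderivZ a^-1 (has_cderiv_e2pi m z).
  by rewrite mulrA mulVf// mul1r.
- exact: entire_e2pi.
Qed.

Definition fourier_coef g m : C := cint (fun x => g x * echar (- m) x).

Lemma ccontM_echar g m : ccont g -> ccont (fun x => g x * echar m x).
Proof. by move=> cg; apply: ccontM => //; exact: ccont_echar. Qed.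

Lemma ccontZ c g : ccont g -> ccont (fun x => c * g x).
Proof. by move=> cg; apply: ccontM => //; exact: ccont_cst. Qed.

(** Orthogonality of the characters: removing one harmonic lowers the squared
    norm by the squared modulus of its coefficient. *)
Lemma bessel_step g m c : ccont g -> fourier_coef g m = c ->
  cint (fun x => (g x - c * echar m x) * (g x - c * echar m x)^*) =
  cint (fun x => g x * (g x)^*) - c * c^*.
Proof.
move=> cg gm; have cge := ccontM_echar (- m) cg.
have E x : (g x - c * echar m x) * (g x - c * echar m x)^* =
    (g x * (g x)^* + (- c^*) * (g x * echar (- m) x)) +
    ((- c) * (g x * echar (- m) x)^* + c * c^*).
  have e1 : echar m x * echar (- m) x = 1 by rewrite -echarD subrr echar0.
  have := echar_conj (- m) x; rewrite opprK; move: (echar_conj m x) e1.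
  move: (echar m x) (echar (- m) x) (g x) => e e' G he e2pi' he'.
  rewrite !rmorphB !rmorphM /= he he'.
  by rewrite -[in RHS](mulr1 (c * c^*)) -e2pi'; ring.
have cgg : ccont (fun x => g x * (g x)^*) by apply: ccontM => //; exact: ccont_conj.
have ccj := ccont_conj cge.
have cA := ccontZ (- c^*) cge; have cB := ccontZ (- c) ccj.
have cC := ccont_cst (c * c^*).
rewrite (cint_ext E) (cintD (ccontD cgg cA) (ccontD cB cC)) (cintD cgg cA).
rewrite (cintD cB cC) (cintZ _ cge) (cintZ _ ccj) cint_cst.
by rewrite cint_conj// -/(fourier_coef g m) gm; ring.
Qed.

Lemma cint_sq_ge0 g : ccont g -> 0 <= complex.Re (cint (fun x => g x * (g x)^*)).
Proof.
move=> cg; have [c1 _] : ccont (fun x => g x * (g x)^*).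
  by apply: ccontM => //; exact: ccont_conj.
rewrite /cint /=; have [t _ ->] := rint_mean c1.
by case: (g t) => a b; simpc; rewrite /= addr_ge0// -expr2 sqr_ge0.
Qed.

(** A weak form of the Riemann-Lebesgue lemma, from Bessel's inequality: after
    removing N harmonics with coefficient c the squared norm has dropped by
    N |c|^2, yet it stays nonnegative. *)
Lemma bessel_cst g c (s : nat -> int) : injective s -> ccont g ->
  (forall j, fourier_coef g (s j) = c) -> c = 0.
Proof.
move=> si cg gc.
(* The function g with N of its harmonics removed. *)
pose r N x := g x - c * \sum_(j < N) echar (s j) x.
have rS N x : r N.+1 x = r N x - c * echar (s N) x.
  by rewrite /r big_ord_recr /=; ring.
have key N : [/\ ccont (r N), forall j, (N <= j)%N -> fourier_coef (r N) (s j) = c &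
    cint (fun x => r N x * (r N x)^*) = cint (fun x => g x * (g x)^*) - N%:R * (c * c^*)].
  elim: N => [|N [IH1 IH2 IH3]].
    have -> : r 0%N = g by apply/funext => x; rewrite /r big_ord0 mulr0 subr0.
    by rewrite mul0r subr0.
  have -> : r N.+1 = (fun x => r N x + (- c) * echar (s N) x).
    by apply/funext => x; rewrite rS mulNr.
  have crN : ccont (fun x => r N x + - c * echar (s N) x).
    by apply: ccontD => //; apply: ccontZ; exact: ccont_echar.
  split => //.
    move=> j Nj; rewrite /fourier_coef.
    rewrite (cint_ext (h :=
      fun x => r N x * echar (- s j) x + (- c) * echar (s N - s j) x)); last first.
      by move=> x; rewrite echarD; ring.
    rewrite (cintD (ccontM_echar _ IH1) (ccontZ _ (ccont_echar _))) (cintZ _ (ccont_echar _)).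
    rewrite cint_echar ?mulr0 ?addr0; first by apply: IH2; rewrite ltnW.
    by rewrite subr_eq0; apply: contraTneq Nj => /si ->; rewrite ltnn.
  rewrite (cint_ext (h := fun x => (r N x - c * echar (s N) x) *
    (r N x - c * echar (s N) x)^*)); last by move=> x; rewrite mulNr.
  rewrite (bessel_step IH1 (IH2 N (leqnn N))) IH3 -natr1; ring.
apply/eqP; rewrite -cmod_eq0; apply: contraT => c0.
set I := complex.Re (cint (fun x => g x * (g x)^*)).
have cpos : 0 < cmod c ^+ 2 by rewrite exprn_gt0// lt0r c0 cmod_ge0.
have hN N : N%:R * cmod c ^+ 2 <= I.
  have [k1 _ k3] := key N; have := cint_sq_ge0 k1; rewrite k3.
  have -> : N%:R * (c * c^*) = (N%:R * cmod c ^+ 2)%:C.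
    by rewrite -sqr_normc normCE -rmorphXn -(rmorph_nat (real_complex R)) -rmorphM.
  by rewrite /I; case: (cint _) => a b; simpc; rewrite /= subr_ge0.
have := hN (Num.bound (I / cmod c ^+ 2)); rewrite -ler_pdivlMr// leNgt.
have I0 : 0 <= I := cint_sq_ge0 cg.
by rewrite archi_boundP// divr_ge0// ltW.
Qed.

End Fourier.

(** * Uniqueness of quasi-periodic entire functions *)

Section FourierUniqueness.
Variable R : realType.
Local Notation C := R[i].
Implicit Types (f h : C -> C) (m n : int) (x : R) (c : C).

Lemma has_cderivV f (z d : C) : f z != 0 -> has_cderiv f z d ->
  exists d', has_cderiv (fun w => (f w)^-1) z d'.
Proof.
move=> fz fd; have /derivable_has_cderiv fd' : exists d, has_cderiv f z d by exists d.
have H := @derivableV R[i] (R[i])^o f z 1 fz fd'.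
exact: ((derivable_has_cderiv (fun w => (f w)^-1) z).1 H).
Qed.

Lemma periodic_int f : (forall z, f (z + 1) = f z) ->
  forall m (z : C), f (z + m%:~R) = f z.
Proof.
move=> fp; have pn (n : nat) z : f (z + n%:R) = f z.
  by elim: n => [|n IH]; rewrite ?addr0// -natr1 addrA fp.
case=> n z; first exact: pn.
by rewrite NegzE rmorphN /= -(pn n.+1 (z - _)) -pmulrn subrK.
Qed.

Lemma e2pi_periodic_int m (z : C) : e2pi (z + m%:~R) = e2pi z.
Proof. by rewrite e2piD e2pi_int mulr1. Qed.

(** At the integers the quotient (h(x) - h(0)) / (e(x) - 1) extends continuously
    by the value h'(0) / (2 pi i), because the denominator has a simple zero there. *)
Lemma chernoff_quotient h : entire h -> (forall z, h (z + 1) = h z) ->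
  exists k : R -> C, ccont k /\
    forall x, h x%:C = h 0 + k x * (echar 1 x - 1).
Proof.
move=> he hp; have hpi := periodic_int hp.
have em1E x : echar 1 x = e2pi x%:C by rewrite /echar mul1r.
have [d hd] := he 0; pose a : C := 2 * piC * iC.
have a0 : a != 0 := two_pi_i_neq0 R.
have eed z : has_cderiv (fun w => e2pi w) z (a * e2pi z).
  exact: has_cderiv_expC.
pose c0 := d / a.
pose k x := if echar 1 x == 1 then c0 else (h x%:C - h 0) / (echar 1 x - 1).
exists k; split; last first.
  move=> x; rewrite /k; case: eqVneq => [e1|e1].
    rewrite e1 subrr mulr0 addr0; have [m ->] : exists m : int, x%:C = m%:~R.
      by apply: e2pi_eq1; rewrite -em1E.
    by rewrite -(hpi m 0) add0r.
  by rewrite divfK ?subr_eq0// addrC subrK.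
apply: ccontP => x e e0; have [e1|e1] := eqVneq (echar 1 x) 1.
  have [m xm] : exists m : int, x%:C = m%:~R by apply: e2pi_eq1; rewrite -em1E.
  have kx : k x = c0 by rewrite /k e1 eqxx.
  have e20 : 0 < e / 2 by rewrite divr_gt0.
  (* c0 is chosen so that h - c0 e has derivative 0 at the origin. *)
  have num : has_cderiv (fun w => h w + (- c0) * e2pi w) 0 0.
    have := has_cderivD hd (has_cderivZ (- c0) (eed 0)).
    by rewrite e2pi0 mulr1 mulNr /c0 divfK// subrr.
  have [r r0 hr] := num _ e20; have [s s0 hs] := eed 0 1 ltr01.
  exists (Num.min r s); first by rewrite lt_min r0.
  move=> t; rewrite -(cmodR t) lt_min => /andP[tr ts].
  have emt : echar 1 (x + t) = e2pi t%:C.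
    by rewrite em1E rmorphD /= addrC xm e2pi_periodic_int.
  rewrite kx /k emt; case: eqVneq => [_|en]; first by rewrite subrr cmod0.
  have -> : h (x + t)%:C = h t%:C by rewrite rmorphD /= addrC xm hpi.
  have en' : e2pi t%:C - 1 != 0 by rewrite subr_eq0.
  have -> : (h t%:C - h 0) / (e2pi t%:C - 1) - c0 =
     (h t%:C - c0 * e2pi t%:C - (h 0 - c0)) / (e2pi t%:C - 1) by field.
  have := hr _ tr; rewrite add0r e2pi0 mulr1 mul0r subr0 mulNr => H1.
  have := hs _ ts; rewrite add0r e2pi0 mulr1 mul1r => H2.
  have t0 : 0 < cmod t%:C.
    by rewrite cmod_gt0; apply: contra_neq en => ->; rewrite e2pi0.
  have ca : 2 <= cmod a.
    rewrite /a !cmodM cmod_nat /piC /iC cmodR cmod_i normr1 mulr1.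
    by have := pi_ge2 R; rewrite ger0_norm ?pi_ge0//; lra.
  have H3 : cmod t%:C <= cmod (e2pi t%:C - 1).
    have := cmodB (e2pi t%:C - 1) (e2pi t%:C - 1 - a * t%:C).
    rewrite (_ : _ - (_ - _) = a * t%:C); last by ring.
    rewrite cmodM; nra.
  rewrite cmodM cmodV ltr_pdivrMr; last exact: lt_le_trans H3.
  apply: le_lt_trans H1 _; nra.
have en : e2pi x%:C - 1 != 0 by rewrite -em1E subr_eq0.
have den : has_cderiv (fun w => e2pi w - 1) x%:C (a * e2pi x%:C).
  move=> u u0; have [r r0 hr] := eed x%:C u u0; exists r => // w /hr.
  by rewrite opprB addrA subrK.
have num : exists d', has_cderiv (fun w => h w - h 0) x%:C d'.
  have [d' hd'] := he x%:C; exists d' => u u0.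
  have [r r0 hr] := hd' u u0; exists r => // w /hr.
  by rewrite opprB addrA subrK.
have [d1 hd1] := num; have [d2 hd2] := @has_cderivV (fun w => e2pi w - 1) _ _ en den.
have [r r0 hr] := has_cderiv_cont (has_cderivM hd1 hd2) e0.
have [s s0 hs] : exists2 s : R, 0 < s & forall w, cmod w < s ->
  e2pi (x%:C + w) - 1 != 0.
  have en0 : 0 < cmod (e2pi x%:C - 1) by rewrite cmod_gt0.
  have [s s0 hs] := has_cderiv_cont den en0.
  exists s => // w /hs; apply: contraTneq => ->.
  by rewrite sub0r cmodN ltxx.
exists (Num.min r s); first by rewrite lt_min r0.
move=> t; rewrite -(cmodR t) lt_min => /andP[/hr tr /hs ts].
rewrite /k (negPf e1) !em1E rmorphD /=.
by rewrite -subr_eq0 (negPf ts).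
Qed.

(** Chernoff's argument. Write h = h(0) + k (e - 1) with k continuous. The
    hypothesis says that the coefficients of k satisfy
    k_m - k_(m-1) = h(0) if m = 0 and 0 otherwise, so they are constant on m >= 0
    and on m < 0. By [bessel_cst] both constants vanish, and so does their
    difference h(0). This avoids any convergence theorem for Fourier series. *)
Lemma fourier_eq0_at0 h : entire h -> (forall z, h (z + 1) = h z) ->
  (forall m, fourier_coef (fun x => h x%:C) m = 0) -> h 0 = 0.
Proof.
move=> he hp hm; have [k [ck hk]] := chernoff_quotient he hp.
(* Coefficient m of h = h(0) + k (e - 1), which vanishes by hypothesis. *)
have rec m : fourier_coef k m - fourier_coef k (m - 1) = if m == 0 then h 0 else 0.
  have cm : ccont (fun x => k x * echar (- (m - 1)) x) := ccontM_echar _ ck.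
  have cm' : ccont (fun x => (-1) * (k x * echar (- m) x)).
    by apply: ccontZ; exact: ccontM_echar.
  have c3 : ccont (fun x => h 0 * echar (- m) x) by apply: ccontZ; exact: ccont_echar.
  have := hm m; rewrite /fourier_coef.
  rewrite (cint_ext (h := fun x => h 0 * echar (- m) x +
     (k x * echar (- (m - 1)) x + (-1) * (k x * echar (- m) x)))); last first.
    by move=> x; rewrite hk opprB echarD; ring.
  rewrite (cintD c3 (ccontD cm cm')) (cintD cm cm') (cintZ _ (@ccont_echar R _)).
  rewrite (cintZ _ (ccontM_echar _ ck)) => E.
  have E' : cint (fun x => k x * echar (- m) x) - cint (fun x => k x * echar (- (m - 1)) x)
     = h 0 * cint (echar (- m)) by apply/eqP; rewrite -subr_eq0 -oppr_eq0; apply/eqP;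
      rewrite -[RHS]E; ring.
  rewrite E'; case: eqVneq => [->|m0].
    rewrite (cint_ext (h := fun=> 1)) ?cint_cst ?mulr1// => x.
    by rewrite oppr0 echar0.
  by rewrite cint_echar ?mulr0// oppr_eq0.
have pos (j : nat) : fourier_coef k j = fourier_coef k 0.
  elim: j => [//|j IH]; rewrite -IH; apply/eqP; rewrite -subr_eq0.
  by have := rec j.+1%:Z; rewrite (_ : j.+1%:Z - 1 = j%:Z) => [->//|]; lia.
have neg (j : nat) : fourier_coef k (- (j.+1%:Z)) = fourier_coef k (-1).
  elim: j => [//|j IH]; rewrite -IH; apply/eqP; rewrite eq_sym -subr_eq0.
  have := rec (- j.+1%:Z); rewrite oppr_eq0 /= => <-.
  by apply/eqP; congr (fourier_coef _ _ - fourier_coef _ _); lia.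
have k0 : fourier_coef k 0 = 0.
  apply: (@bessel_cst _ k _ (fun j => j%:Z)) => //; by move=> i j [].
have k1 : fourier_coef k (-1) = 0.
  by apply: (@bessel_cst _ k _ (fun j => - (j.+1%:Z))) => // i j; lia.
by have := rec 0; rewrite eqxx sub0r k0 k1 subr0.
Qed.

(** Cauchy's theorem applied to f(z) e(-mz): the Fourier coefficients of f on
    different horizontal lines determine each other. *)
Lemma fourier_coef_shift f (w : C) m : entire f -> (forall z, f (z + 1) = f z) ->
  fourier_coef (fun x => f (x%:C + w)) m = e2pi (m%:~R * w) * fourier_coef (fun x => f x%:C) m.
Proof.
move=> fe fp; pose g z := f z * e2pi ((- m)%:~R * z).
have ge : entire g by apply: entireM => //; exact: entire_e2pi.
have gp z : g (z + 1) = g z.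
  by rewrite /g fp mulrDr mulr1 e2pi_periodic_int.
rewrite {2}/fourier_coef -[X in _ * X](periodic_mean w ge gp) -cintZ; last first.
  have := ccont_entire w 1 ge; rewrite (_ : (fun x => _) = (fun x => g (x%:C + w)))//.
  by apply/funext => x; rewrite mulr1 addrC.
apply: cint_ext => x; rewrite /g /echar mulrDr e2piD.
have H : e2pi (m%:~R * w) * e2pi ((- m)%:~R * w) = 1.
  by rewrite -e2piD rmorphN mulNr subrr e2pi0.
move: H; move: (e2pi (m%:~R * w)) (e2pi ((- m)%:~R * w)) => a b ab1.
move: (e2pi _) (f _) => c d.
by rewrite -[LHS]mulr1 -ab1; ring.
Qed.

(** Every point is the origin of some translate of f, and by
    [fourier_coef_shift] translates keep vanishing coefficients. *)
Lemma fourier_eq0 f : entire f -> (forall z, f (z + 1) = f z) ->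
  (forall m, fourier_coef (fun x => f x%:C) m = 0) -> forall z, f z = 0.
Proof.
move=> fe fp fm z; have := @fourier_eq0_at0 (fun w => f (w + z)).
rewrite add0r; apply; first exact: entire_shift.
  by move=> w; rewrite addrAC fp.
by move=> m; rewrite fourier_coef_shift// fm mulr0.
Qed.

(** The scalar equation satisfied by each matrix entry of a solution when B is
    diagonal. *)
Definition quasi_periodic (tau v : C) f := [/\ entire f, forall z, f (z + 1) = f z &
  forall z, f (z + tau) = - e2pi (- (z + v + tau)) * f z].

(** Comparing Fourier coefficients on the lines through 0 and tau turns the
    quasi-period into a two-term recursion. *)
Lemma quasi_periodic_fourier_coef tau v f m : quasi_periodic tau v f ->
  e2pi (m%:~R * tau) * fourier_coef (fun x => f x%:C) m =
  - e2pi (- (v + tau)) * fourier_coef (fun x => f x%:C) (m + 1).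
Proof.
move=> [fe fp ft]; rewrite -fourier_coef_shift// /fourier_coef.
rewrite -cintZ; last by apply: ccontM_echar; exact: ccont_real.
apply: cint_ext => x; rewrite ft.
have -> : echar (- (m + 1)) x = echar (- m) x * e2pi (- x%:C).
  by rewrite opprD echarD {2}/echar rmorphN mulNr mul1r.
have -> : e2pi (- (x%:C + v + tau)) = e2pi (- x%:C) * e2pi (- (v + tau)).
  by rewrite -e2piD; congr e2pi; ring.
ring.
Qed.

(** The recursion has nonzero factors, so a single coefficient determines all
    the others. *)
Lemma quasi_periodic_fourier_coef0 tau v f : quasi_periodic tau v f ->
  fourier_coef (fun x => f x%:C) 0 = 0 -> forall z, f z = 0.
Proof.
move=> qf f0; have [fe fp _] := qf; apply: fourier_eq0 => //.
have up m : fourier_coef (fun x => f x%:C) m = 0 ->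
  fourier_coef (fun x => f x%:C) (m + 1) = 0.
  move=> fm; have := quasi_periodic_fourier_coef m qf; rewrite fm mulr0 => /esym/eqP.
  by rewrite mulf_eq0 oppr_eq0 (negPf (e2pi_neq0 _)) => /eqP.
have down m : fourier_coef (fun x => f x%:C) (m + 1) = 0 ->
  fourier_coef (fun x => f x%:C) m = 0.
  move=> fm; have := quasi_periodic_fourier_coef m qf; rewrite fm mulr0 => /eqP.
  by rewrite mulf_eq0 (negPf (e2pi_neq0 _)) => /eqP.
elim/int_rect => // n IH.
  by rewrite intS addrC; exact: up.
by apply: down; rewrite (_ : _ + 1 = - n%:Z)//; lia.
Qed.

Lemma quasi_periodic_lin tau v f g c : quasi_periodic tau v f ->
  quasi_periodic tau v g ->
  quasi_periodic tau v (fun z => f z + c * g z).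
Proof.
move=> [fe fp ft] [ge gp gt].
split; first by apply: entireD => //; exact: entireZ.
  by move=> z; rewrite fp gp.
by move=> z; rewrite ft gt; ring.
Qed.

(** The reason why the solutions have dimension at most 1: with a, b the zeroth
    coefficients of f, g, the combination b f - a g has zeroth coefficient 0, hence
    vanishes; evaluating at 0 gives a g(0) = 0, so a = 0 and f = 0. *)
Lemma quasi_periodic_uniq tau v f g : quasi_periodic tau v f ->
  quasi_periodic tau v g ->
  f 0 = 0 -> g 0 != 0 -> forall z, f z = 0.
Proof.
move=> qf qg f0 g0; apply: quasi_periodic_fourier_coef0 (qf) _.
set a := fourier_coef _ _; set b := fourier_coef (fun x => g x%:C) 0.
have [fe fp ft] := qf; have [ge gp gt] := qg.
have qh : quasi_periodic tau v (fun z => b * f z + (- a) * g z).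
  split; first by apply: entireD; exact: entireZ.
    by move=> z; rewrite fp gp.
  by move=> z; rewrite ft gt; ring.
have h0 := quasi_periodic_fourier_coef0 qh.
have : fourier_coef (fun x => b * f x%:C + - a * g x%:C) 0 = 0.
  have cf := ccontM_echar (- 0) (ccont_real fe); have cg :=
    ccontM_echar (- 0) (ccont_real ge).
  rewrite /fourier_coef (cint_ext (h := fun x => b * (f x%:C * echar (- 0) x) +
    (- a) * (g x%:C * echar (- 0) x))); last by move=> x; ring.
  rewrite (cintD (ccontZ _ cf) (ccontZ _ cg)) (cintZ _ cf) (cintZ _ cg).
  by rewrite -/(fourier_coef (fun x => f x%:C) 0) -/(fourier_coef (fun x => g x%:C) 0) -/a -/b; ring.
move=> /h0 /(_ 0); rewrite f0 mulr0 add0r => /eqP.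
by rewrite mulf_eq0 (negPf g0) orbF oppr_eq0 => /eqP.
Qed.

End FourierUniqueness.

(** * The finite Jacobi triple product *)

Section TripleProduct.
Variables (F : fieldType) (p t : F).
Implicit Types (N m k : nat).

Definition qpoch N : F := \prod_(j < N) (1 - p ^+ j.+1).

Hypothesis qpoch_neq0 : forall N, qpoch N != 0.
Hypothesis t0 : t != 0.

(** The reciprocal of the q-Pochhammer symbol (p; p)_(k-1), extended by 0 to
    k = 0. With this convention [inv_qpochS] also holds at k = 0, and the truncated
    difference in [qbin] makes the coefficients beyond the range vanish, so that
    the recurrences need no boundary cases. *)
Definition inv_qpoch k : F := if k is k'.+1 then (qpoch k')^-1 else 0.

Lemma qpochS N : qpoch N.+1 = qpoch N * (1 - p ^+ N.+1).
Proof. by rewrite /qpoch big_ord_recr. Qed.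

Lemma inv_qpochS k : inv_qpoch k = inv_qpoch k.+1 * (1 - p ^+ k).
Proof.
case: k => [|k] /=; first by rewrite expr0 subrr mulr0.
have := qpoch_neq0 k.+1; rewrite qpochS mulf_eq0 negb_or => /andP[h1 h2].
by rewrite invfM divfK.
Qed.

(** The Gaussian binomial coefficient with upper index 2 N + 1 and lower index
    N - m, in base p. *)
Definition qbin N m := qpoch N.*2.+1 * inv_qpoch (N.+1 - m) * inv_qpoch (N + m).+2.

Lemma qbin_gt N m : (N < m)%N -> qbin N m = 0.
Proof. by move=> Nm; rewrite /qbin (_ : N.+1 - m = 0)%N ?mulr0 ?mul0r//; lia. Qed.

Lemma qbinS0 N : qbin N.+1 0 = (1 + p ^+ N.+1 ^+ 2) * qbin N 0 +
  p ^+ N.+1 * qbin N 0 + p ^+ N.+2 * qbin N 1.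
Proof.
rewrite /qbin !subn0 !addn0 subSS subn0 addn1 doubleS (qpochS N.*2.+2) (qpochS N.*2.+1).
rewrite (inv_qpochS N) (inv_qpochS N.+1) (inv_qpochS N.+2) -exprM.
have -> : p ^+ N.*2.+2 = p ^+ N.+1 * p ^+ N.+1 by rewrite -exprD; congr (_ ^+ _); lia.
have -> : p ^+ N.*2.+3 = p * (p ^+ N.+1 * p ^+ N.+1).
  by rewrite -exprD -exprS; congr (_ ^+ _); lia.
have -> : p ^+ (N.+1 * 2) = p ^+ N.+1 * p ^+ N.+1 by rewrite -exprD;
  congr (_ ^+ _); lia.
rewrite !exprS; ring.
Qed.

Lemma qbinSS N m : (m <= N)%N -> qbin N.+1 m.+1 =
  (1 + p ^+ N.+1 ^+ 2) * qbin N m.+1 + p ^+ (N - m) * qbin N m +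
  p ^+ (N + m).+3 * qbin N m.+2.
Proof.
move=> mN; have [k Nk] : exists k, N = (k + m)%N by exists (N - m)%N; lia.
rewrite /qbin doubleS (qpochS N.*2.+2) (qpochS N.*2.+1).
have -> : (N.+2 - m.+1 = k.+1)%N by lia.
have -> : (N.+1 - m.+1 = k)%N by lia.
have -> : (N.+1 - m = k.+1)%N by lia.
have -> : (N.+1 - m.+2 = k.-1)%N by lia.
have -> : (N - m = k)%N by lia.
rewrite !addnS addSn.
rewrite (inv_qpochS (N + m).+2) (inv_qpochS (N + m).+3).
set s := (N + m)%N.
have E1 : p ^+ N.*2.+2 = p ^+ k * (p ^+ s * p ^+ 2).
  by rewrite -!exprD; congr (_ ^+ _); rewrite /s; lia.
have E3 : p ^+ N.*2.+3 = p * p ^+ N.*2.+2 by rewrite exprS.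
have E2 : p ^+ N.+1 ^+ 2 = p ^+ N.*2.+2 by rewrite -exprM; congr (_ ^+ _); lia.
have S2 : p ^+ s.+2 = p ^+ s * p ^+ 2 by rewrite -exprD addn2.
have S3 : p ^+ s.+3 = p * (p ^+ s * p ^+ 2) by rewrite -exprD -exprS addn2.
rewrite E3 E2 E1 S3 S2.
case: k {Nk E1} => [|k]; first by rewrite /= expr0; ring.
by rewrite -[k.+1.-1]/k (inv_qpochS k) (inv_qpochS k.+1) exprS; ring.
Qed.

Definition triple_base m : F := t ^+ m - t^-1 ^+ m.+1.
(** The sum of the terms of index m and -m-1 of the theta series in t = e(z),
    p = e(tau). They carry the same Gaussian binomial in the finite product,
    which is why the bilateral sum is folded in this way. *)
Definition triple_term m : F := (-1) ^+ m * p ^+ (m * m.+1)./2 * triple_base m.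

Lemma triple_base_rec m :
  (t + t^-1) * triple_base m.+1 = triple_base m.+2 + triple_base m.
Proof.
rewrite /triple_base !exprS; move: (t ^+ m) (t^-1 ^+ m) => a b; field; exact: t0.
Qed.

Lemma triangS m : (m.+1 * m.+2)./2 = ((m * m.+1)./2 + m.+1)%N.
Proof.
have -> : (m.+1 * m.+2 = m * m.+1 + m.+1.*2)%N by lia.
by rewrite halfD odd_double andbF add0n doubleK.
Qed.

(** The case m = 0 differs because the predecessor of term 0 in the bilateral sum
    is term 0 itself: folding identifies the indices m and -m-1. *)
Lemma triple_term_rec0 N : - p ^+ N.+1 * (t + t^-1) * triple_term 0 =
  p ^+ N * triple_term 1 + p ^+ N.+1 * triple_term 0.
Proof.
rewrite /triple_term /triple_base /= !expr1 !expr0 exprS; field; exact: t0.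
Qed.

Lemma triple_term_recS N m : (m < N)%N -> - p ^+ N.+1 * (t + t^-1) * triple_term m.+1 =
  p ^+ (N - m.+1) * triple_term m.+2 + p ^+ (N + m).+2 * triple_term m.
Proof.
move=> mN; have [k Nk] : exists k, N = (k + m.+1)%N by exists (N - m.+1)%N; lia.
have -> : (N - m.+1 = k)%N by lia.
rewrite /triple_term !triangS.
set a := (-1) ^+ m.+1; set b := p ^+ (_ + _).
have -> : - p ^+ N.+1 * (t + t^-1) * (a * b * triple_base m.+1) =
  - p ^+ N.+1 * (a * b) * ((t + t^-1) * triple_base m.+1) by ring.
rewrite triple_base_rec /a /b.
have -> : p ^+ N.+1 = p ^+ k * p ^+ m.+2 by rewrite -exprD; congr (_ ^+ _); lia.
have -> : p ^+ (N + m).+2 = p ^+ k * p ^+ m.+2 * p ^+ m.+1.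
  by rewrite -!exprD; congr (_ ^+ _); lia.
rewrite !exprD !exprS; ring.
Qed.

(** Induction on N. One more pair of factors multiplies by
    1 + p^(2N+2) - p^(N+1) (t + 1/t), and multiplication by t + 1/t shifts the
    terms by one in both directions; the resulting three-term recurrence is the
    one satisfied by the Gaussian binomials. *)
Lemma finite_triple_product N :
  (1 - t^-1) * \prod_(j < N) ((1 - p ^+ j.+1 * t) * (1 - p ^+ j.+1 / t)) =
  \sum_(m < N.+1) qbin N m * triple_term m.
Proof.
elim: N => [|N IH].
  have q00 : qbin 0 0 = 1.
    rewrite /qbin /= (_ : qpoch 0 = 1) ?invr1 ?mulr1 ?divff//.
    by rewrite /qpoch big_ord0.
  by rewrite big_ord0 big_ord1 q00 /triple_term /triple_base !expr0 expr1 mulr1 !mul1r.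
rewrite [in LHS]big_ord_recr /=. rewrite (mulrA (1 - t^-1)). rewrite IH.
have -> : (1 - p ^+ N.+1 * t) * (1 - p ^+ N.+1 / t) =
   (1 + p ^+ N.+1 ^+ 2) - p ^+ N.+1 * (t + t^-1) by field; exact: t0.
rewrite mulrC mulrDl -mulNr.
have cut (G : nat -> F) j : \sum_(m < N.+1 + j) qbin N m * G m =
    \sum_(m < N.+1) qbin N m * G m.
  rewrite big_split_ord /= [X in _ + X]big1 ?addr0// => i _.
  by rewrite qbin_gt ?mul0r//=; lia.
rewrite [RHS]big_ord_recl qbinS0.
have -> : \sum_(i < N.+1) qbin N.+1 (lift ord0 i) * triple_term (lift ord0 i) =
   \sum_(i < N.+1) (1 + p ^+ N.+1 ^+ 2) * qbin N i.+1 * triple_term i.+1 +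
   \sum_(i < N.+1) p ^+ (N - i) * qbin N i * triple_term i.+1 +
   \sum_(i < N.+1) p ^+ (N + i).+3 * qbin N i.+2 * triple_term i.+1.
  rewrite -!big_split /=; apply: eq_bigr => i _.
  by rewrite /bump /= add1n (qbinSS (ltnSE (ltn_ord i))) !mulrDl.
have T1 : (1 + p ^+ N.+1 ^+ 2) * (\sum_(m < N.+1) qbin N m * triple_term m) =
   (1 + p ^+ N.+1 ^+ 2) * qbin N 0 * triple_term 0 +
   \sum_(i < N.+1) (1 + p ^+ N.+1 ^+ 2) * qbin N i.+1 * triple_term i.+1.
  rewrite -(cut _ 1%N) addn1 big_ord_recl mulrDr mulrA mulr_sumr; congr (_ + _).
  by apply: eq_bigr => i _; rewrite /= /bump /= add1n mulrA.
(* The part with t + 1/t: split off m = 0, where the index is reflected. *)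
have T2 : - p ^+ N.+1 * (t + t^-1) * (\sum_(m < N.+1) qbin N m * triple_term m) =
   (p ^+ N.+1 * qbin N 0 * triple_term 0 + p ^+ N.+2 * qbin N 1 * triple_term 0) +
   (\sum_(i < N.+1) p ^+ (N - i) * qbin N i * triple_term i.+1 +
    \sum_(i < N.+1) p ^+ (N + i).+3 * qbin N i.+2 * triple_term i.+1).
  rewrite mulr_sumr.
  have third :
    p ^+ N.+1 * qbin N 0 * triple_term 0 + p ^+ N.+2 * qbin N 1 * triple_term 0 +
      \sum_(i < N.+1) p ^+ (N + i).+3 * qbin N i.+2 * triple_term i.+1 =
      p ^+ N.+1 * qbin N 0 * triple_term 0 +
      \sum_(i < N) p ^+ (N + i).+2 * qbin N i.+1 * triple_term i.
    rewrite -addrA; congr (_ + _).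
    have := @big_ord_recl _ 0 +%R N.+1 (fun i => p ^+ (N + i).+2 * qbin N i.+1 * triple_term i).
    rewrite /= addn0 => E.
    rewrite [in LHS](eq_bigr (fun i : 'I_N.+1 => p ^+ (N + lift ord0 i).+2 *
      qbin N (lift ord0 i).+1 * triple_term (lift ord0 i))); last first.
      by move=> i _; rewrite /= /bump /= add1n addnS.
    rewrite -E !big_ord_recr /= (@qbin_gt N N.+1)// (@qbin_gt N N.+2)//.
    by rewrite !(mulr0, mul0r, addr0).
  rewrite [RHS]addrA [RHS]addrAC third big_ord_recl [X in _ = _ + X]big_ord_recl.
  have -> : - p ^+ N.+1 * (t + t^-1) * (qbin N 0 * triple_term 0) =
     qbin N 0 * (p ^+ N * triple_term 1 + p ^+ N.+1 * triple_term 0).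
    by rewrite -triple_term_rec0; ring.
  have -> : \sum_(i < N) - p ^+ N.+1 * (t + t^-1) *
        (qbin N (lift ord0 i) * triple_term (lift ord0 i)) =
     \sum_(i < N) p ^+ (N + i).+2 * qbin N i.+1 * triple_term i +
     \sum_(i < N) p ^+ (N - lift ord0 i) * qbin N (lift ord0 i) * triple_term (lift ord0 i).+1.
    rewrite -big_split /=; apply: eq_bigr => i _; rewrite /= /bump /= add1n.
    have -> : - p ^+ N.+1 * (t + t^-1) * (qbin N i.+1 * triple_term i.+1) =
      qbin N i.+1 * (- p ^+ N.+1 * (t + t^-1) * triple_term i.+1) by ring.
    by rewrite triple_term_recS//; ring.
  rewrite -[nat_of_ord ord0]/0%N subn0; ring.
rewrite T1 T2 -[nat_of_ord ord0]/0%N; ring.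
Qed.

End TripleProduct.

(** * Tannery's theorem *)

Section Tannery.
Variable R : realType.
Local Notation C := R[i].
Implicit Types (N m : nat).

Lemma clim_sum (u : nat -> nat -> C) (l : nat -> C) M :
  (forall m, clim (fun N => u N m) (l m)) ->
  clim (fun N => \sum_(m < M) u N m) (\sum_(m < M) l m).
Proof.
move=> ul; elim: M => [|M IH].
  rewrite big_ord0; apply: clim_ext (clim_cst 0) => N; by rewrite big_ord0.
rewrite big_ord_recr /=; apply: clim_ext (climD IH (ul M)) => N.
by rewrite big_ord_recr.
Qed.

(** Dominated convergence for series: outside a finite range the sum is uniformly
    small, inside it every coefficient tends to 1. *)
Lemma tannery (d : nat -> nat -> C) (b : nat -> C) (K : R) (G : C) :
  (forall N m, cmod (d N m) <= K) -> (forall m, clim (fun N => d N m) 1) ->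
  abs_summable b -> clim (csum b) G ->
  clim (fun N => \sum_(m < N.+1) d N m * b m) G.
Proof.
move=> dK d1 [Kb hb] bG.
have K0 : 0 <= K := le_trans (cmod_ge0 _) (dK 0%N 0%N).
have err : clim (fun N => \sum_(m < N.+1) (d N m - 1) * b m) 0.
  move=> e e0; pose eta := e / (2 * (K + 2)).
  have eta0 : 0 < eta by rewrite divr_gt0// mulr_gt0// ltr_wpDl.
  have [M hM] := real_summable_tail (fun i => cmod_ge0 (b i)) hb eta0.
  have hd : clim (fun N => \sum_(m < M) (d N m - 1) * b m) 0.
    have E0 : \sum_(m < M) (1 - 1) * b m = 0.
      by rewrite big1// => i _; rewrite subrr mul0r.
    have := @clim_sum (fun N m => (d N m - 1) * b m) (fun m => (1 - 1) * b m) M.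
    rewrite E0; apply => m.
    apply: climM; last exact: clim_cst.
    by apply: climD => //; exact: clim_cst.
  have e20 : 0 < e / 2 by rewrite divr_gt0.
  have [N0 hN0] := hd _ e20; exists (maxn M N0) => N; rewrite geq_max => /andP[MN N0N].
  have := hN0 N N0N; rewrite !subr0.
  rewrite -(big_mkord xpredT (fun m => (d N m - 1) * b m)).
  rewrite -(big_mkord xpredT (fun m => (d N m - 1) * b m)).
  rewrite (@big_cat_nat _ _ _ M 0 N.+1)//=; last exact: leqW.
  set A := \sum_(0 <= i < M) _; set B := \sum_(M <= i < _) _ => hA.
  have hB : cmod B <= (K + 1) * eta.
    apply: le_trans (cmod_sum _ _ _) _.
    apply: le_trans (_ : \sum_(M <= i < N.+1) (K + 1) * cmod (b i) <= _).
      apply: ler_sum => i _; rewrite cmodM ler_wpM2r ?cmod_ge0//.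
      by rewrite (le_trans (cmodB _ _))// cmod1 lerD2r.
    by rewrite -mulr_sumr ler_wpM2l ?addr_ge0.
  have hK : (K + 1) * eta < e / 2.
    have -> : e / 2 = (K + 2) * eta by rewrite /eta; field; lra.
    by rewrite ltr_pM2r// ltrD2l; lra.
  have := cmodD A B; lra.
apply: (@clim_ext _ (fun N => csum b N.+1 + \sum_(m < N.+1) (d N m - 1) * b m)).
  move=> N; rewrite /csum -big_split /=; apply: eq_bigr => i _; ring.
rewrite -[G]addr0; apply: climD => //.
exact: (clim_sub (s := S)).
Qed.

End Tannery.

(** * Bounds for infinite products *)

Section ProductBounds.
Variable R : realType.
Local Notation C := R[i].
Implicit Types (N m j : nat) (s r : R).

Lemma geometric_sum_le r N : 0 <= r < 1 -> \sum_(j < N) r ^+ j <= (1 - r)^-1.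
Proof.
move=> /andP[r0 r1]; have r2 : 0 < 1 - r by lra.
rewrite -[leRHS]mul1r ler_pdivlMr//.
have : \sum_(j < N) r ^+ j * (1 - r) = 1 - r ^+ N.
  elim: N => [|N IH]; first by rewrite big_ord0 expr0 subrr.
  by rewrite big_ord_recr /= IH exprSr; ring.
by rewrite mulr_suml => ->; rewrite lerBlDr lerDl exprn_ge0.
Qed.

(** From 1 - y >= exp(-y / (1 - s)) for 0 <= y <= s < 1. The bound is uniform
    over all families dominated by one geometric sequence; this uniformity gives
    not only that theta has no other zeros but also that its zeros are simple. *)
Lemma prod_lower s r : 0 <= s < 1 -> 0 <= r < 1 -> exists2 delta : R, 0 < delta &
  forall (x : nat -> C), (forall j, cmod (x j) <= s * r ^+ j) ->
  forall N, delta <= cmod (\prod_(j < N) (1 - x j)).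
Proof.
move=> /andP[s0 s1] /andP[r0 r1]; have s2 : 0 < 1 - s by lra.
have r2 : 0 < 1 - r by lra.
exists (expR (- (s / (1 - s) * (1 - r)^-1))); first exact: expR_gt0.
move=> x hx N.
have fac j : expR (- (s / (1 - s) * r ^+ j)) <= cmod (1 - x j).
  have := cmod_ge_sub 1 (x j); rewrite cmod1; apply: le_trans.
  set y := s * r ^+ j.
  have y0 : 0 <= y by rewrite mulr_ge0// exprn_ge0.
  have ys : y <= s by rewrite ler_piMr// exprn_ile1// ltW.
  have y1 : 0 < 1 - y by lra.
  apply: le_trans (_ : 1 - y <= _); last by rewrite lerB.
  rewrite mulrAC -/y expRN -[leRHS]invrK lef_pV2 ?posrE ?expR_gt0 ?invr_gt0//.
  apply: le_trans (_ : expR (y / (1 - y)) <= _); last first.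
    by rewrite ler_expR ler_wpM2l// lef_pV2 ?posrE//; lra.
  have yE : (1 - y)^-1 = 1 + y / (1 - y) by field; lra.
  by rewrite [leLHS]yE expR_ge1Dx.
have -> : cmod (\prod_(j < N) (1 - x j)) = \prod_(j < N) cmod (1 - x j) by exact: cmod_prod.
apply: le_trans (_ : \prod_(j < N) expR (- (s / (1 - s) * r ^+ j)) <= _); last first.
  by apply: ler_prod => j _; rewrite expR_ge0 fac.
rewrite -expR_sum ler_expR sumrN lerN2 -mulr_sumr ler_wpM2l//.
  by rewrite divr_ge0// ltW.
by rewrite geometric_sum_le// r0.
Qed.

Lemma qpoch_upper (p : C) : cmod p < 1 -> exists K : R, forall N, cmod (qpoch p N) <= K.
Proof.
move=> p1; exists (expR ((1 - cmod p)^-1)) => N; rewrite /qpoch cmod_prod.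
apply: le_trans (_ : \prod_(j < N) expR (cmod p ^+ j) <= _).
  apply: ler_prod => j _; rewrite cmod_ge0 /= (le_trans (cmodB _ _))// cmod1 cmodX.
  apply: le_trans (expR_ge1Dx _); rewrite lerD2l exprS ler_piMl ?exprn_ge0 ?cmod_ge0//.
  exact: ltW.
by rewrite -expR_sum ler_expR geometric_sum_le// cmod_ge0.
Qed.

Lemma qpoch_lower (p : C) : cmod p < 1 -> exists2 delta : R, 0 < delta &
  forall N, delta <= cmod (qpoch p N).
Proof.
move=> p1; have h : 0 <= cmod p < 1 by rewrite cmod_ge0.
have [delta d0 hd] := prod_lower h h; exists delta => // N.
by apply: (hd (fun j => p ^+ j.+1)) => j; rewrite cmodX exprS.
Qed.

(** Successive differences are dominated by a geometric sequence, and the lower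
    bound survives in the limit. *)
Lemma qpoch_cvg (p : C) : cmod p < 1 -> exists2 L, L != 0 & clim (qpoch p) L.
Proof.
move=> p1; have [K hK] := qpoch_upper p1; have [delta d0 hd] := qpoch_lower p1.
have h : 0 <= cmod p < 1 by rewrite cmod_ge0.
have K0 : 0 <= K := le_trans (cmod_ge0 _) (hK 0%N).
have sa : abs_summable (fun j => - (p ^+ j.+1 * qpoch p j)).
  exists (K * (1 - cmod p)^-1) => m.
  apply: le_trans (_ : \sum_(i < m) K * cmod p ^+ i <= _); last first.
    by rewrite -mulr_sumr ler_wpM2l// geometric_sum_le.
  apply: ler_sum => i _;
    rewrite cmodN cmodM cmodX mulrC ler_pM ?cmod_ge0 ?exprn_ge0 ?cmod_ge0//.
  by rewrite exprS ler_piMl ?exprn_ge0 ?cmod_ge0// ltW.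
have [l hl] := abs_summable_cvg sa; exists (1 + l).
  rewrite -cmod_gt0; apply: lt_le_trans d0 _.
  apply: (clim_cmod_ge (u := qpoch p)) => //.
  apply: clim_ext (climD (clim_cst 1) hl) => N /=.
  elim: N => [|N IH]; first by rewrite /csum /qpoch !big_ord0 addr0.
  by rewrite /csum big_ord_recr /= addrA -/(csum _ N) IH qpochS; ring.
apply: clim_ext (climD (clim_cst 1) hl) => N /=.
elim: N => [|N IH]; first by rewrite /csum /qpoch !big_ord0 addr0.
by rewrite /csum big_ord_recr /= addrA -/(csum _ N) IH qpochS; ring.
Qed.

(** After normalization by (p; p)_N the coefficients of the finite triple product
    are bounded and tend to 1, so the finite sums tend to the full series. *)
Lemma triple_product_cvg (p t G : C) : cmod p < 1 -> t != 0 ->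
  abs_summable (triple_term p t) -> clim (csum (triple_term p t)) G ->
  clim (fun N => qpoch p N * ((1 - t^-1) *
     \prod_(j < N) ((1 - p ^+ j.+1 * t) * (1 - p ^+ j.+1 / t)))) G.
Proof.
move=> p1 t0 sb hG.
have [K hK] := qpoch_upper p1; have [delta d0 hd] := qpoch_lower p1.
have qn0 N : qpoch p N != 0 by rewrite -cmod_gt0; exact: lt_le_trans (hd N).
have K0 : 0 <= K := le_trans (cmod_ge0 _) (hK 0%N).
have [L L0 hL] := qpoch_cvg p1.
have hinv k : cmod (inv_qpoch p k) <= delta^-1.
  case: k => [|k]; first by rewrite -[inv_qpoch p 0]/(0 : C) cmod0 invr_ge0 ltW.
  by rewrite -[inv_qpoch p _]/((qpoch p k)^-1) cmodV lef_pV2 ?posrE// (lt_le_trans d0).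
have T : clim (fun N => \sum_(m < N.+1) (qpoch p N * qbin p N m) * triple_term p t m) G.
  apply: (@tannery R (fun N m => qpoch p N * qbin p N m) (triple_term p t)
    (K * (K * delta^-1 * delta^-1)) G) => //.
    move=> N m; rewrite /qbin !cmodM; do 3?[apply: ler_pM;
      rewrite ?mulr_ge0 ?cmod_ge0//].
  move=> m; have sh (s : nat -> nat) : (forall N, (N <= s N)%N) ->
      clim (fun N => qpoch p (s N)) L.
    by move=> hs; exact: clim_sub hL.
  have -> : (1 : C) = L * (L * L^-1 * L^-1) by field.
  have ev : clim (fun N => inv_qpoch p (N.+1 - m)) L^-1.
    have := climV L0 hL => hV e /hV[N0 hN0]; exists (N0 + m)%N => N hN.
    have -> : (N.+1 - m = (N - m).+1)%N by lia.
    by apply: hN0; lia.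
  apply: climM => //; apply: climM; first apply: climM => //.
    by apply: sh => N; lia.
  have := climV L0 hL => hV e /hV[N0 hN0]; exists N0 => N hN.
  by apply: hN0; lia.
apply: clim_ext T => N; rewrite (finite_triple_product qn0 t0) mulr_sumr.
by apply: eq_bigr => i _; rewrite mulrA.
Qed.

End ProductBounds.

(** * The theta functions *)

Section Theta.
Variables (R : realType) (tau : R[i]).
Local Notation C := R[i].
Hypothesis htau : 0 < complex.Im tau.
Implicit Types (z w : C) (m : int) (N i : nat).

Let A : R := pi * complex.Im tau.

Lemma pi_Im_tau_gt0 : 0 < A.
Proof. by rewrite mulr_gt0 ?pi_gt0. Qed.

Definition theta_coef m : C := expC (piC * iC * m%:~R ^+ 2 * tau).
Definition theta_freq m : C := 2 * piC * iC * m%:~R.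

Lemma thetabar_termE z m :
  thetabar_term tau z m = theta_coef m * expC (theta_freq m * z).
Proof. by rewrite /thetabar_term expCD. Qed.

Lemma cmod_theta_coef m : cmod (theta_coef m) = expR (- A * m%:~R ^+ 2).
Proof.
rewrite /theta_coef cmod_expC; congr expR.
rewrite -(rmorph_int (real_complex R)) /piC /iC /A expr2; case: tau => a b; simpc.
by rewrite /= expr2; ring.
Qed.

Lemma cmod_theta_freq m : cmod (theta_freq m) = 2 * pi * `|m%:~R|.
Proof.
rewrite /theta_freq !cmodM cmod_nat -(rmorph_int (real_complex R)) !cmodR cmod_i normr1 mulr1.
by rewrite (ger0_norm (pi_ge0 R)).
Qed.

(** Completing the square: -A i^2 + rho (i + 1) <= M - i, so the Gaussian factor
    beats every exponential and leaves a geometric series. *)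
Lemma gauss_superexp (k : nat -> int) :
  (forall i, i%:R <= `|(k i)%:~R| :> R) -> (forall i, `|(k i)%:~R| <= i.+1%:R :> R) ->
  superexp (fun i => theta_coef (k i)) (fun i => theta_freq (k i)).
Proof.
move=> k1 k2 r; pose rho := `|r| * (2 * pi).
have rho0 : 0 <= rho by rewrite mulr_ge0// mulr_ge0// pi_ge0.
have A0 := pi_Im_tau_gt0.
pose M := rho + (rho + 1) ^+ 2 / (4 * A).
have q01 : 0 <= expR (-1 : R) < 1 by rewrite expR_ge0 /= expR_lt1 ltrN10.
exists (expR M * (1 - expR (-1))^-1) => m.
apply: le_trans (_ : \sum_(i < m) expR M * expR (-1) ^+ i <= _); last first.
  by rewrite -mulr_sumr ler_wpM2l ?expR_ge0// geometric_sum_le.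
apply: ler_sum => i _;
  rewrite cmod_theta_coef cmod_theta_freq -expRM_natl -!expRD ler_expR.
set x := `|(k i)%:~R|; have x1 := k1 i; have x2 := k2 i.
have hx : (k i)%:~R ^+ 2 = x ^+ 2 :> R by rewrite /x real_normK// num_real.
have i0 : 0 <= i%:R :> R by [].
rewrite hx; have xx : i%:R ^+ 2 <= x ^+ 2 by rewrite ler_sqr ?nnegrE// (le_trans i0).
have h1 : - A * x ^+ 2 <= - A * i%:R ^+ 2 by rewrite !mulNr lerN2 ler_wpM2l// ltW.
have h2 : r * (2 * pi * x) <= rho * (i%:R + 1).
  rewrite mulrA; apply: le_trans (_ : rho * x <= _).
    rewrite ler_wpM2r ?normr_ge0// /rho ler_wpM2r ?ler_norm//.
    by rewrite mulr_ge0// pi_ge0.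
  by rewrite ler_wpM2l// natr1.
have h3 : 0 <= A * (i%:R - (rho + 1) / (2 * A)) ^+ 2 by rewrite mulr_ge0 ?sqr_ge0// ltW.
have h4 : A * (i%:R - (rho + 1) / (2 * A)) ^+ 2 =
  A * i%:R ^+ 2 - (rho + 1) * i%:R + (rho + 1) ^+ 2 / (4 * A).
  by field; rewrite gt_eqF.
rewrite h4 in h3; rewrite /M; lra.
Qed.

Lemma posz_superexp :
  superexp (fun i => theta_coef (Posz i)) (fun i => theta_freq (Posz i)).
Proof.
by apply: gauss_superexp => i; rewrite -pmulrn ger0_norm// ler_nat.
Qed.

Lemma negz_superexp :
  superexp (fun i => theta_coef (Negz i)) (fun i => theta_freq (Negz i)).
Proof.
by apply: gauss_superexp => i;
  rewrite NegzE rmorphN normrN /= -pmulrn ger0_norm// ler_nat.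
Qed.

Definition thetabar_pos z : C :=
  limn (series (fun m : nat => thetabar_term tau z (Posz m)) : nat -> C^o).
Definition thetabar_neg z : C :=
  limn (series (fun m : nat => thetabar_term tau z (Negz m)) : nat -> C^o).

Lemma pos_summable z : abs_summable (fun i => thetabar_term tau z (Posz i)).
Proof.
have := superexp_summable z posz_superexp.
by under [fun i => _ * _]funext do rewrite -thetabar_termE.
Qed.

Lemma neg_summable z : abs_summable (fun i => thetabar_term tau z (Negz i)).
Proof.
have := superexp_summable z negz_superexp.
by under [fun i => _ * _]funext do rewrite -thetabar_termE.
Qed.

Lemma thetabar_pos_cvg z :
  clim (csum (fun i => thetabar_term tau z (Posz i))) (thetabar_pos z).
Proof.
have [l hl] := abs_summable_cvg (pos_summable z).
by rewrite /thetabar_pos seriesE (clim_lim hl).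
Qed.

Lemma thetabar_neg_cvg z :
  clim (csum (fun i => thetabar_term tau z (Negz i))) (thetabar_neg z).
Proof.
have [l hl] := abs_summable_cvg (neg_summable z).
by rewrite /thetabar_neg seriesE (clim_lim hl).
Qed.

Lemma thetabarE z : thetabar tau z = thetabar_pos z + thetabar_neg z.
Proof. by []. Qed.

Lemma thetabar_entire : entire (thetabar tau).
Proof.
apply: (@entireD R thetabar_pos thetabar_neg).
  apply: (exp_series_entire posz_superexp) => z.
  by under [fun i => _ * _]funext do rewrite -thetabar_termE; exact: thetabar_pos_cvg.
apply: (exp_series_entire negz_superexp) => z.
by under [fun i => _ * _]funext do rewrite -thetabar_termE; exact: thetabar_neg_cvg.
Qed.

Lemma thetabar1 z : thetabar tau (z + 1) = thetabar tau z.
Proof.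
have E : thetabar_term tau (z + 1) = thetabar_term tau z.
  apply/funext => m; rewrite !thetabar_termE mulrDr expCD mulr1 /theta_freq.
  by have := e2pi_int R m; rewrite /e2pi => ->; rewrite mulr1.
by rewrite /thetabar E.
Qed.

(** The translation by tau shifts the summation index by one; in the split sum
    the term of index 0 moves from the nonnegative half to the negative one. *)
Lemma thetabar_tau z : thetabar tau (z + tau) =
  expC (- (piC * iC * tau + 2 * piC * iC * z)) * thetabar tau z.
Proof.
set E := expC _.
have T m : thetabar_term tau (z + tau) m = E * thetabar_term tau z (m + 1).
  rewrite /thetabar_term /E -expCD; congr expC; rewrite rmorphD /=; ring.
have hP : clim (csum (fun i => thetabar_term tau (z + tau) (Posz i)))
    (E * (thetabar_pos z - thetabar_term tau z 0)).
  apply: (@clim_ext _ (fun N => E * (csum (fun i => thetabar_term tau z (Posz i)) N.+1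
     + - thetabar_term tau z 0))).
    move=> N; rewrite {1}/csum big_ord_recl addrAC subrr add0r mulr_sumr.
    apply: eq_bigr => i _; rewrite T; congr (_ * thetabar_term _ _ _).
    by rewrite /= /bump /= -PoszD addn1 add1n.
  apply: climM; first exact: clim_cst.
  apply: climD; last exact: clim_cst.
  exact: (clim_sub (s := S)) (thetabar_pos_cvg z).
have hN : clim (fun N => csum (fun i => thetabar_term tau (z + tau) (Negz i)) N.+1)
    (E * (thetabar_term tau z 0 + thetabar_neg z)).
  apply: (@clim_ext _ (fun N => E * (thetabar_term tau z 0 +
     csum (fun i => thetabar_term tau z (Negz i)) N))).
    move=> N; rewrite [in RHS]/csum big_ord_recl T mulrDr; congr (_ + _).
    rewrite mulr_sumr; apply: eq_bigr => i _; rewrite T;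
      congr (_ * thetabar_term _ _ _).
    by rewrite /= /bump /=; lia.
  apply: climM; first exact: clim_cst.
  apply: climD; [exact: clim_cst|exact: thetabar_neg_cvg].
rewrite !thetabarE (clim_uniq (thetabar_pos_cvg _) hP).
have hN' : clim (fun N => csum (fun i => thetabar_term tau (z + tau) (Negz i)) N.+1)
    (thetabar_neg (z + tau)) by exact: (clim_sub (s := S)) (thetabar_neg_cvg _).
rewrite (clim_uniq hN' hN); ring.
Qed.

(** The third theta function translated so that its zeros lie on the lattice. It
    is the first theta function up to a factor without zeros, see [thetaE]. *)
Definition theta_shift z := thetabar tau (z + (tau + 1) / 2).

Lemma theta_shift_entire : entire theta_shift.
Proof. exact: entire_shift thetabar_entire. Qed.

Lemma theta_shift_quasi_periodic : quasi_periodic tau 0 theta_shift.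
Proof.
split; first exact: theta_shift_entire.
  by move=> z; rewrite /theta_shift addrAC thetabar1.
move=> z; rewrite /theta_shift addrAC thetabar_tau; congr (_ * _).
have e : expC (- (piC * iC)) = -1 :> C by rewrite expCN expC_pi1 invrN1.
rewrite addr0 -[RHS]mulN1r -e /e2pi -expCD; congr expC; by field.
Qed.

Lemma theta_shift_translate_quasi_periodic u :
  quasi_periodic tau u (fun z => theta_shift (z + u)).
Proof.
have [ge g1 gt] := theta_shift_quasi_periodic; split; first exact: entire_shift.
  by move=> z; rewrite addrAC g1.
by move=> z; rewrite addrAC gt addr0 (addrAC z).
Qed.

Lemma nome_triang (i : nat) :
  expC ((i * i.+1)%:R * (piC * iC * tau)) = e2pi tau ^+ (i * i.+1)./2.
Proof.
have half : ((i * i.+1)./2 * 2 = i * i.+1)%N.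
  by rewrite muln2 -[RHS](odd_double_half) oddM /=; case: (odd i).
rewrite -e2piMn /e2pi; congr expC; rewrite -{1}half natrM; ring.
Qed.

(** At the half period the terms of the third theta series are
    (-1)^m p^(m(m+1)/2) t^m, and the triangular exponent is the same for m and
    -m-1. *)
Lemma pair_termE z (i : nat) :
  thetabar_term tau (z + (tau + 1) / 2) (Posz i) +
  thetabar_term tau (z + (tau + 1) / 2) (Negz i) = triple_term (e2pi tau) (e2pi z) i.
Proof.
have Tm m : thetabar_term tau (z + (tau + 1) / 2) m =
    expC (m%:~R * (piC * iC)) * expC (m%:~R * (m%:~R + 1) * (piC * iC * tau)) * e2pi (m%:~R * z).
  rewrite /thetabar_term /e2pi -!expCD; congr expC; by field.
have P : expC (i%:R * (i%:R + 1) * (piC * iC * tau)) = e2pi tau ^+ (i * i.+1)./2.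
  by rewrite -nome_triang natrM -natr1.
rewrite !Tm NegzE rmorphN /= -!pmulrn mulNr expCN !expC_nat expC_pi1 P.
have -> : (- i.+1%:R * (- i.+1%:R + 1)) = i%:R * (i%:R + 1) :> C by rewrite -natr1;
  ring.
rewrite P /triple_term /triple_base -[_ ^- _]exprVn invrN1 mulNr e2piN !e2piMn exprVn [(-1) ^+ i.+1]exprS.
ring.
Qed.

Lemma triple_term_summable z : abs_summable (triple_term (e2pi tau) (e2pi z)).
Proof.
have [K1 h1] := pos_summable (z + (tau + 1) / 2).
have [K2 h2] := neg_summable (z + (tau + 1) / 2).
exists (K1 + K2) => m; apply: le_trans (lerD (h1 m) (h2 m)).
rewrite -big_split /=; apply: ler_sum => i _; rewrite -pair_termE; exact: cmodD.
Qed.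

Lemma theta_shift_cvg z : clim (csum (triple_term (e2pi tau) (e2pi z))) (theta_shift z).
Proof.
apply: clim_ext (climD (thetabar_pos_cvg _) (thetabar_neg_cvg _)) => m /=.
by rewrite -csumD; apply: eq_bigr => i _; rewrite pair_termE.
Qed.

Definition theta_scale : C := 2 * nome_pow tau 4^-1 / (2 * iC).

Lemma iC_neq0 : iC != 0 :> C.
Proof. by rewrite /iC eq_complex /= eqxx oner_eq0. Qed.

Lemma theta_scale_neq0 : theta_scale != 0.
Proof.
have n2 : (2 : C) != 0 by rewrite pnatr_eq0.
apply: mulf_neq0; first exact: (mulf_neq0 n2 (expC_neq0 _)).
by rewrite invr_eq0; exact: (mulf_neq0 n2 iC_neq0).
Qed.

(** Both series have the same terms: folding the indices m and -m-1 produces the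
    sine of (2m+1) pi z, up to the factor exp(pi i z) that centres the exponents. *)
Lemma thetaE z : theta tau z = theta_scale * expC (piC * iC * z) * theta_shift z.
Proof.
have T (m : nat) : (-1) ^+ m * nome_pow tau (m * m.+1)%:R
    * sinC ((2 * m + 1)%:R * piC * z) =
    (2 * iC)^-1 * expC (piC * iC * z) * triple_term (e2pi tau) (e2pi z) m.
  rewrite /nome_pow nome_triang /sinC /triple_term /triple_base.
  have -> : expC (iC * ((2 * m + 1)%:R * piC * z)) = expC (piC * iC * z) * e2pi z ^+ m.
    by rewrite -e2piMn /e2pi -expCD; congr expC; rewrite natrD natrM; ring.
  have -> : expC (- (iC * ((2 * m + 1)%:R * piC * z))) =
      expC (piC * iC * z) * (e2pi z)^-1 ^+ m.+1.
    rewrite -e2piN -e2piMn /e2pi -expCD; congr expC; rewrite natrD natrM -natr1; ring.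
  ring.
rewrite /theta seriesE (_ : (fun m : nat => _) =
   (fun m : nat => (2 * iC)^-1 * expC (piC * iC * z) * triple_term (e2pi tau) (e2pi z) m)); last first.
  by apply/funext.
have L : clim (csum (fun m :
  nat => (2 * iC)^-1 * expC (piC * iC * z) * triple_term (e2pi tau) (e2pi z) m))
    ((2 * iC)^-1 * expC (piC * iC * z) * theta_shift z).
  apply: clim_ext (climM (clim_cst _) (theta_shift_cvg z)) => m.
  by rewrite csumZ.
by rewrite (clim_lim L) /theta_scale; ring.
Qed.

(** In this strip |p^j t| and |p^j / t| are at most s r^(j-1) for j >= 1, where
    r = |p| and s = sqrt r, so all factors of the triple product other than
    1 - 1/t are bounded away from 0 uniformly in z and in the number of factors. *)
Lemma theta_shift_lower : exists2 delta : R, 0 < delta & forall z,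
  `|complex.Im z| <= complex.Im tau / 2 ->
    delta * cmod (1 - e2pi (- z)) <= cmod (theta_shift z).
Proof.
have A0 := pi_Im_tau_gt0; pose s := expR (- A); pose r := cmod (e2pi tau).
have rE : r = expR (- A - A).
  by rewrite /r cmod_e2pi /A; congr expR; ring.
have s01 : 0 <= s < 1 by rewrite expR_ge0 expR_lt1 oppr_lt0.
have r01 : 0 <= r < 1 by rewrite rE expR_ge0 expR_lt1; lra.
have r1 : cmod (e2pi tau) < 1 by case/andP: r01.
have [d1 d10 h1] := qpoch_lower r1; have [d2 d20 h2] := prod_lower s01 r01.
exists (d1 * (d2 * d2)); first by rewrite !mulr_gt0.
move=> z hz; have pi0 := pi_gt0 R.
have bnd : `|2 * pi * complex.Im z| <= A.
  have pi20 : 0 <= 2 * pi :> R by lra.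
  rewrite normrM (ger0_norm pi20) /A.
  have : 2 * pi * `|complex.Im z| <= 2 * pi * (complex.Im tau / 2).
    by rewrite ler_wpM2l.
  lra.
move: bnd; rewrite ler_norml => /andP[b1 b2].
have step (w : C) : cmod w <= expR A -> forall j,
  cmod (e2pi tau ^+ j.+1 * w) <= s * r ^+ j.
  move=> hw j; rewrite cmodM cmodX -/r exprS.
  have -> : s = r * expR A by rewrite rE -expRD /s; congr expR; ring.
  have -> : r * r ^+ j * cmod w = r * cmod w * r ^+ j by ring.
  apply: ler_wpM2r; first by rewrite exprn_ge0 ?cmod_ge0.
  by apply: ler_wpM2l; first exact: cmod_ge0.
have c1 : cmod (e2pi z) <= expR A by rewrite cmod_e2pi ler_expR; lra.
have c2 : cmod (e2pi z)^-1 <= expR A by rewrite -e2piN cmod_e2pi ler_expR;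
  case: (z) b1 b2 => a b /=; lra.
apply: (clim_cmod_ge (triple_product_cvg r1 (e2pi_neq0 z) (triple_term_summable z) (theta_shift_cvg z))) => N.
rewrite !cmodM big_split cmodM e2piN.
rewrite -mulrA; apply: ler_pM; rewrite ?(ltW d10) ?mulr_ge0 ?cmod_ge0 ?(ltW d20)//.
rewrite mulrC; apply: ler_wpM2l; first exact: cmod_ge0.
apply: ler_pM; rewrite ?(ltW d20)//.
  by apply: (h2 (fun j => e2pi tau ^+ j.+1 * e2pi z)); exact: step.
by apply: (h2 (fun j => e2pi tau ^+ j.+1 / e2pi z)); exact: step.
Qed.

(** Quasi-periodicity moves u into the strip of [theta_shift_lower], where a zero
    forces e(-u) = 1. *)
Lemma theta_shift_neq0 u : ~ lattice tau u -> theta_shift u != 0.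
Proof.
move=> ul; have [delta d0 hd] := theta_shift_lower.
(* b is Im u / Im tau rounded to the nearest integer. *)
pose b := Num.floor (complex.Im u / complex.Im tau + 2^-1).
pose u0 := u - b%:~R * tau.
have [_ _ gt] := theta_shift_quasi_periodic.
have up z : theta_shift z != 0 -> theta_shift (z + tau) != 0.
  by move=> h; rewrite gt mulf_neq0// oppr_eq0 e2pi_neq0.
have down z : theta_shift (z + tau) != 0 -> theta_shift z != 0.
  by rewrite gt; apply: contra_neq => ->; rewrite mulr0.
have shift (k : int) z : theta_shift z != 0 -> theta_shift (z + k%:~R * tau) != 0.
  move=> hz; elim/int_rect: k => [|n IH|n IH]; first by rewrite mul0r addr0.
    rewrite (_ : z + _ = z + n%:~R * tau + tau); first exact: up.
    by rewrite intS rmorphD /=; ring.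
  apply: down; rewrite (_ : z + _ + tau = z + (- n%:Z)%:~R * tau)//.
  by rewrite intS !rmorphN rmorphD /=; ring.
have -> : u = u0 + b%:~R * tau by rewrite /u0 subrK.
apply: shift; rewrite -cmod_gt0.
have Imu0 : complex.Im u0 = complex.Im u - b%:~R * complex.Im tau.
  rewrite /u0 -(rmorph_int (real_complex R)); case: (u) (tau) => ? ? [? ?] /=.
  by rewrite mul0r addr0.
have f1 := floor_le (complex.Im u / complex.Im tau + 2^-1).
have f2 := floorD1_gt (complex.Im u / complex.Im tau + 2^-1).
have Eu : complex.Im u = complex.Im u / complex.Im tau * complex.Im tau.
  by rewrite divfK// gt_eqF.
have hz : `|complex.Im u0| <= complex.Im tau / 2.
  rewrite Imu0 ler_norml Eu; move: f1 f2; rewrite -/b intrD.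
  rewrite -[1%:~R]/(1 : R) => f1 f2.
  have := mulr_ge0 (ltW htau) (_ : 0 <= complex.Im u / complex.Im tau + 2^-1 - b%:~R).
  have := mulr_ge0 (ltW htau) (_ :
    0 <= b%:~R + 1 - (complex.Im u / complex.Im tau + 2^-1)).
  rewrite !subr_ge0 => /(_ (ltW f2)) g2 /(_ f1) g1; apply/andP; split; lra.
apply: lt_le_trans (hd _ hz); rewrite mulr_gt0// cmod_gt0.
rewrite subr_eq0; apply/negP => /eqP/esym/e2pi_eq1[m hm]; apply: ul.
exists (- m), b; rewrite rmorphN /= -hm opprK /u0; ring.
Qed.

Lemma theta_shift0 : theta_shift 0 = 0.
Proof.
apply: clim_uniq (theta_shift_cvg 0) _; apply: clim_ext (clim_cst 0) => m.
rewrite /csum big1// => i _;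
  rewrite /triple_term /triple_base e2pi0 expr1n invr1 expr1n subrr mulr0.
by [].
Qed.

(** The lower bound of [theta_shift_lower] is linear near 0, so the zero at 0 is
    simple. *)
Lemma theta_shift_derive_neq0 d : has_cderiv theta_shift 0 d -> d != 0.
Proof.
move=> hd; apply/eqP => d0; rewrite d0 in hd.
have [delta delta0 hl] := theta_shift_lower.
have e20 : 0 < delta / 2 by rewrite divr_gt0.
have [r r0 hr] := hd _ e20.
have [q q0 hq] := @has_cderiv_e2pi R (-1) 0 1 ltr01.
pose h : R := Num.min r q / 2.
have m0 : 0 < Num.min r q by rewrite lt_min r0.
have h0 : 0 < h by rewrite divr_gt0.
have ch : cmod h%:C = h by rewrite cmodR gtr0_norm.
have hm : h < Num.min r q by rewrite /h; lra.
have [hlr hlq] : h < r /\ h < q by move: hm; rewrite lt_min => /andP.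
have k1 := hr h%:C; rewrite ch add0r theta_shift0 subr0 mul0r subr0 in k1.
have {}k1 := k1 hlr.
have k2 := hq h%:C; rewrite ch add0r mulr0 e2pi0 mulr1 mul1r in k2.
have {}k2 := k2 hlq.
have k3 : delta * cmod (1 - e2pi (- h%:C)) <= cmod (theta_shift h%:C).
  by apply: hl; rewrite /= normr0 divr_ge0// ltW.
have eN : e2pi ((-1)%:~R * h%:C) = e2pi (- h%:C) by congr e2pi;
  rewrite rmorphN /= mulN1r.
rewrite eN in k2.
have := cmodB (e2pi (- h%:C) - 1) (e2pi (- h%:C) - 1 - 2 * piC * iC * (-1)%:~R * h%:C).
rewrite (_ : _ - (_ - _) = - (2 * piC * iC) * h%:C); last first.
  by rewrite rmorphN /=; ring.
have c2 : cmod (- (2 * piC * iC) * h%:C) = 2 * pi * h.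
  rewrite cmodM ch cmodN !cmodM cmod_nat /piC /iC cmodR cmod_i normr1 mulr1.
  by rewrite (ger0_norm (pi_ge0 R)).
rewrite c2 (cmodBC (e2pi _) 1); have := pi_ge2 R => p2 k4.
have k5 : h <= cmod (1 - e2pi (- h%:C)).
  have : 4 * h <= 2 * pi * h by apply: (ler_wpM2r (ltW h0)); lra.
  lra.
have := ler_wpM2l (ltW delta0) k5; have := mulr_gt0 delta0 h0; lra.
Qed.

End Theta.

(** * The solution attached to a diagonal matrix *)

Lemma tensmxZr (K : comNzRingType) (m n p q : nat) (A : 'M[K]_(m, n)) (c : K)
  (D : 'M[K]_(p, q)) : A *t (c *: D) = c *: (A *t D).
Proof.
apply/matrixP => i j; case: (mxtens_indexP i) => i1 i2.
by case: (mxtens_indexP j) => j1 j2; rewrite [RHS]mxE !tensmxE mxE mulrCA.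
Qed.

Theorem theorem4p2 (R : realType) (n : nat) (hn : (0 < n)%N)
    (tau : R[i]) (htau : 0 < complex.Im tau) (lambda : 'I_n -> R[i])
    (B : 'M[R[i]]_n)
    (hB : B = diag_mx (\row_k expC (2 * piC * iC * lambda k)))
    (v y : R[i]) (hv : ~ Sigma tau B v) (hy : ~ lattice tau y) :
  rB tau B v y =
    (derive1 (thetabar tau : R[i] -> (R[i])^o) ((tau + 1) / 2))^-1 *:
    \sum_(k < n) \sum_(l < n)
      kronecker tau (v - (lambda k - lambda l)) y
      *: (delta_mx l k *t delta_mx k l).
Proof.
set c := (tau + 1) / 2.
have [d hd] : exists d, has_cderiv (theta_shift tau) 0 d := theta_shift_entire htau 0.
have d0 := theta_shift_derive_neq0 htau hd.
have hd' : has_cderiv (thetabar tau) c d.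
  move=> e e0; have [r r0 hr] := hd e e0; exists r => // h /hr.
  by rewrite /theta_shift !add0r (addrC h).
rewrite (has_cderiv_derive1 hd').
have thd : has_cderiv (theta tau) 0 (theta_scale tau * d).
  have H := has_cderivZ (theta_scale tau) (has_cderivM (has_cderiv_expC 0 (piC * iC)) hd).
  rewrite (theta_shift0 htau) mulr0 add0r mulr0 expC0 mul1r in H.
  have -> : theta tau = (fun w => theta_scale tau * (expC (piC * iC * w) * theta_shift tau w)).
    by apply/funext => w; rewrite (thetaE htau) mulrA.
  exact: H.
pose b k : R[i] := e2pi (lambda k).
have BE : B = diag_mx (\row_k b k) by [].
have b0 k : b k != 0 := e2pi_neq0 _.
have eig k : eigenvalue B (b k).
  apply/eigenvalueP; exists (delta_mx 0 k); last first.
    by apply/eqP => /matrixP/(_ 0 k)/eqP; rewrite !mxE !eqxx oner_eq0.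
  apply/matrixP => i j; rewrite BE mul_mx_diag !mxE ord1 eqxx /=.
  by case: (eqVneq j k) => [->|_]; rewrite ?mul1r ?mulr1 ?mul0r ?mulr0.
pose u k l := v - (lambda k - lambda l).
have un k l : theta_shift tau (u k l) != 0.
  apply: (theta_shift_neq0 htau) => hu; apply: hv.
  exists (lambda k), (lambda l), (u k l); split => //; try exact: eig.
  by rewrite /u addrC subrK.
have kron k l : kronecker tau (u k l) y =
    d * (theta_shift tau (u k l + y) / (theta_shift tau (u k l) * theta_shift tau y)).
  rewrite /kronecker (has_cderiv_derive1 thd) !(thetaE htau).
  have -> : expC (piC * iC * (u k l + y)) =
      expC (piC * iC * u k l) * expC (piC * iC * y) by rewrite -expCD -mulrDr.
  (* A zero of the denominator at y makes both sides 0, as 0^-1 = 0. *)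
  have [->|y0] := eqVneq (theta_shift tau y) 0; first by rewrite !mulr0 !invr0 !mulr0.
  have s0 := theta_scale_neq0 tau; have ukl := un k l.
  have e1 := expC_neq0 (piC * iC * u k l); have e2 := expC_neq0 (piC * iC * y).
  by field; rewrite y0 ukl s0 e1 e2.
(* Conjugation by the diagonal matrix B shifts v by lambda_k - lambda_l. *)
have fac z k l : - e2pi (- (z + u k l + tau)) * b l = efactor tau v z * b k.
  have -> : - (z + u k l + tau) = - (z + v + tau) + (lambda k - lambda l).
    by rewrite /u; ring.
  rewrite e2piD (e2piD (lambda k)) (e2piN (lambda l)) -/(b k) -/(b l).
  rewrite -mulNr -mulrA divfK// /efactor /e2pi mulrN mulNr.
  by [].
have SolE Phi z k l : Phi (z + tau) *m B = efactor tau v z *: (B *m Phi z) ->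
    Phi (z + tau) k l = - e2pi (- (z + u k l + tau)) * Phi z k l.
  move=> /matrixP/(_ k l); rewrite BE mul_mx_diag mul_diag_mx !mxE => E.
  move: (fac z k l) E; move: (- e2pi _) (efactor tau v z) (b k) (Phi z k l).
  move: (Phi (z + tau) k l) (b l) (b0 l) => P' bl bl0 e1 e2 bk P F E.
  by apply: (mulIf bl0); rewrite E mulrA -F mulrAC.
have R0 Z : res0_inv tau B v Z =
    fun z => \matrix_(i,
      j) (Z i j / theta_shift tau (u i j) * theta_shift tau (z + u i j)).
  apply: xget_unique.
    split; last first.
      by apply/matrixP => i j; rewrite mxE add0r divfK.
    split.
    - move=> i j z; apply/derivable_has_cderiv; move: z.
      rewrite (_ :
        (fun w => _) = (fun w => Z i j / theta_shift tau (u i j) * theta_shift tau (w + u i j))).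
        by apply: entireZ; apply: entire_shift; exact: theta_shift_entire.
      by apply/funext => w; rewrite mxE.
    - move=> z; apply/matrixP => i j; rewrite !mxE.
      by have [_ -> _] := theta_shift_translate_quasi_periodic htau (u i j).
    - move=> z; apply/matrixP => i j; rewrite BE mul_mx_diag mul_diag_mx !mxE.
      have [_ _ ->] := theta_shift_translate_quasi_periodic htau (u i j).
      move: (fac z i j) (theta_shift tau (z + u i j)) (_ / _) => F g a.
      move: (- e2pi _) (efactor tau v z) (b i) (b j) F => e1 e2 bi bj F.
      have -> : a * (e1 * g) * bj = e1 * bj * (a * g) by ring.
      by rewrite F; ring.
  move=> Phi [[Phih Phi1 Phit] Phi0]; apply/funext => z; apply/matrixP => k l.
  rewrite mxE.
  have qP : quasi_periodic tau (u k l) (fun w => Phi w k l).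
    split; first by move=> w; apply/derivable_has_cderiv; exact: Phih.
      by move=> w; rewrite Phi1.
    by move=> w; exact: SolE.
  have qC := theta_shift_translate_quasi_periodic htau (u k l).
  have qD := quasi_periodic_lin (- (Z k l / theta_shift tau (u k l))) qP qC.
  have h0 : Phi 0 k l + - (Z k l / theta_shift tau (u k l)) * theta_shift tau (0 + u k l) = 0.
    by rewrite add0r mulNr divfK// -Phi0 subrr.
  have g0 : theta_shift tau (0 + u k l) != 0 by rewrite add0r.
  have /eqP := quasi_periodic_uniq qD qC h0 g0 z.
  by rewrite mulNr subr_eq0 => /eqP.
rewrite scaler_sumr /rB /tensor_of_map; apply: eq_bigr => k _.
rewrite scaler_sumr; apply: eq_bigr => l _.
rewrite kron scalerA mulKf// /rtilde /ev R0.
have -> : \matrix_(i,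
  j) (delta_mx k l i j / theta_shift tau (u i j) * theta_shift tau (y + u i j)) =
    (theta_shift tau (u k l + y) / theta_shift tau (u k l)) *: delta_mx k l.
  apply/matrixP => i j; rewrite !mxE.
  case: (eqVneq i k) => [->|_]; last by rewrite /= !mul0r mulr0.
  case: (eqVneq j l) => [->|_]; last by rewrite /= !mul0r mulr0.
  by rewrite /= mul1r mulr1 (addrC y) mulrC.
rewrite -/(theta_shift tau y) scalerA tensmxZr; congr (_ *: _).
by rewrite mulrC invfM mulrA.
Qed.
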